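(* Let $\kappa_1,\ldots,\kappa_n$ be $n$ independent realizations of a Poisson random process with mean measure $P$ defined on the Borel $\sigma$-field $\mathfrak{B}$ of a topological space $\Omega$. Let $\Theta$ be the set of all measures $P$ on $(\Omega,\mathfrak{B})$ with $P(\Omega)<\infty$, and consider testing $H_0: P\in\Theta_0\subset\Theta$ versus $H_1: P\in\Theta_1\subset\Theta$. (i) Let $\tau_\Psi$ be any one of the weak topology, the $\tau$-topology, or the $\tau_\Phi$-topology on $\Theta$, and let $\Theta_0$ be relatively compact in the $\tau_\Psi$-topology. Then $H_0$ and $H_1$ are distinguishable if the closures of $\Theta_0$ and $\Theta_1$ in the $\tau_\Psi$-topology are disjoint. (ii) If $\Theta_0$ and $\Theta_1$ are relatively compact in the $\tau$-topology, then the converse holds: if $H_0$ and $H_1$ are distinguishable, then the closures of $\Theta_0$ and $\Theta_1$ in the $\tau$-topology are disjoint.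
   Context: For a set $\Psi$ of measurable functions $f:\Omega\to\mathbb{R}$, the $\tau_\Psi$-topology on $\Theta$ is the coarsest topology for which all maps $P\mapsto\int_\Omega f\,dP$, $f\in\Psi$, are continuous. If $\Psi$ is the set of all bounded continuous functions this is the weak topology; if $\Psi$ is the set of indicator functions of all Borel sets it is the $\tau$-topology; if $\Psi=\Phi$ is the set of all bounded measurable functions it is the $\tau_\Phi$-topology. A test $K_n$ is a measurable function of $(\kappa_1,\ldots,\kappa_n)$ with values in $[0,1]$ (the probability of rejecting the hypothesis). $H_0$ and $H_1$ are distinguishable if there is a sequence of tests $K_n$ with $\sup_{P\in\Theta_0}E_P[K_n]\to0$ and $\sup_{P\in\Theta_1}E_P[1-K_n]\to0$ as $n\to\infty$. *)

(* Defs.v *)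
From HB Require Import structures.
From mathcomp Require Import all_boot all_order all_algebra.
From mathcomp Require Import all_classical all_reals all_analysis.
From mathcomp Require Import measurable_realfun.

Set Implicit Arguments.
Unset Strict Implicit.
Unset Printing Implicit Defensive.

Import Order.TTheory GRing.Theory Num.Theory.
Import numFieldNormedType.Exports.

Local Open Scope classical_set_scope.
Local Open Scope ring_scope.

Definition borel (Omega : ptopologicalType) : Type :=
  g_sigma_algebraType (@open Omega).

HB.instance Definition _ (Omega : ptopologicalType) :=
  Measurable.on (borel Omega).

Section finite_measures.
Variables (R : realType) (Omega : ptopologicalType).

(* The set Theta of all finite Borel measures. *)
Definition fmeas : Type := {finite_measure set (borel Omega) -> \bar R}.

HB.instance Definition _ := gen_eqMixin fmeas.
HB.instance Definition _ := gen_choiceMixin fmeas.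

Definition fint (f : borel Omega -> R) (P : fmeas) : R := (\int[P]_x f x)%R.

(* [fmeas] with the coarsest topology making every [fint f], f in Psi,
   continuous. *)
Definition tau_space (Psi : set (borel Omega -> R)) : Type :=
  sup_topology (fun f : {f | Psi f} =>
    Topological.class (initial_topology (fint (sval f)) : topologicalType)).

HB.instance Definition _ (Psi : set (borel Omega -> R)) :=
  Topological.on (tau_space Psi).

Definition bounded_continuous : set (borel Omega -> R) :=
  [set f | continuous (f : Omega -> R) /\ [bounded (f x : R^o) | x in setT]].

Definition borel_indicators : set (borel Omega -> R) :=
  [set \1_B | B in measurable].

Definition bounded_measurable : set (borel Omega -> R) :=
  [set f | measurable_fun setT f /\ [bounded (f x : R^o) | x in setT]].

End finite_measures.

Section independence.
Context {R : realType} {d d' : measure_display}.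
Context {X : measurableType d} {Y : measurableType d'}.

(* Product rule for the full family only: the rule for a subfamily is the case
   where the remaining [A i] are [setT]. *)
Definition mutually_independent (Pr : probability X R) (m : nat)
    (Z : 'I_m -> X -> Y) : Prop :=
  forall A : 'I_m -> set Y, (forall i, measurable (A i)) ->
    fine (Pr (\bigcap_i (Z i @^-1` A i))) =
    \prod_(i < m) fine (Pr (Z i @^-1` A i)).

End independence.

Section point_processes.
Variables (R : realType) (Omega : ptopologicalType).

Record point_measure : Type := PointMeasure {
  pm_val :> {measure set (borel Omega) -> \bar R} ;
  pm_valP : forall B : set (borel Omega), measurable B ->
    pm_val B = +oo%E \/ exists k : nat, pm_val B = (k%:R)%:E }.

HB.instance Definition _ := gen_eqMixin point_measure.
HB.instance Definition _ := gen_choiceMixin point_measure.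

Fact zero_pointP (B : set (borel Omega)) : measurable B ->
  @mzero _ (borel Omega) R B = +oo%E \/
  exists k : nat, @mzero _ (borel Omega) R B = (k%:R)%:E.
Proof. by right; exists 0%N. Qed.

HB.instance Definition _ := isPointed.Build point_measure
  (@PointMeasure mzero zero_pointP).

(* Generators of the smallest sigma-algebra making all counts kappa |-> kappa(B)
   measurable. *)
Definition count_events : set (set point_measure) :=
  \bigcup_(B in (measurable : set (set (borel Omega))))
    preimage_set_system [set: point_measure] (fun kappa => kappa B) measurable.

HB.instance Definition _ := @isMeasurable.Build (sigma_display count_events)
  point_measure <<s count_events >> (@sigma_algebra0 _ setT _)
  (@sigma_algebraC _ count_events) (@sigma_algebra_bigcup _ setT _).

(* The law of a count is spelled out because [poisson_pmf] is constantly 1 at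
   rate 0; here rate 0 gives the Dirac mass at 0. *)
Definition poisson_process d (X : measurableType d) (Pr : probability X R)
    (P : fmeas R Omega) (kappa : X -> point_measure) : Prop :=
  [/\ measurable_fun setT kappa,
      (forall (B : set (borel Omega)) (k : nat), measurable B ->
        Pr [set w | kappa w B = (k%:R)%:E] =
        (expR (- fine (P B)) * fine (P B) ^+ k / k`!%:R)%:E)
    & (forall (m : nat) (B : 'I_m -> set (borel Omega)),
        (forall i, measurable (B i)) -> trivIset setT B ->
        mutually_independent Pr (fun i w => kappa w (B i)))].

(* kappa_1, ..., kappa_n: n independent realizations of a Poisson process with
   mean measure P, on some probability space. *)
Record poisson_sample (P : fmeas R Omega) (n : nat) : Type := PoissonSample {
  ps_display : measure_display ;
  ps_space : measurableType ps_display ;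
  ps_prob : probability ps_space R ;
  ps_kappa : 'I_n -> ps_space -> point_measure ;
  ps_poisson : forall i, poisson_process ps_prob P (ps_kappa i) ;
  ps_indep : mutually_independent ps_prob ps_kappa }.

Arguments ps_kappa {P n} p i w.

Definition is_test n (K : n.-tuple point_measure -> R) : Prop :=
  measurable_fun setT K /\ (forall x, 0 <= K x <= 1).

(* E_P[g(kappa_1, ..., kappa_n)], as a real number; only used for bounded g. *)
Definition sample_mean P n (S : poisson_sample P n)
    (g : n.-tuple point_measure -> R) : R :=
  fine ('E_(ps_prob S)[fun w => g [tuple ps_kappa S i w | i < n]]).

(* [sup] of a set of reals is 0 on the empty set, as it should be here when a
   hypothesis is empty. *)
Definition distinguishable
    (S : forall (P : fmeas R Omega) (n : nat), poisson_sample P n)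
    (Theta0 Theta1 : set (fmeas R Omega)) : Prop :=
  exists K : forall n, n.-tuple point_measure -> R,
    [/\ (forall n, is_test (K n)),
        (fun n => sup [set sample_mean (S P n) (K n) | P in Theta0])
          @ \oo --> (0 : R)
      & (fun n => sup [set sample_mean (S P n) (fun x => 1 - K n x)
                      | P in Theta1]) @ \oo --> (0 : R)].

End point_processes.

(* Main.v *)
Require Import Defs.
From HB Require Import structures.
From mathcomp Require Import all_boot all_order all_algebra.
From mathcomp Require Import all_classical all_reals all_analysis.
From mathcomp Require Import measurable_realfun lra ring.
Import Order.TTheory GRing.Theory Num.Theory.
Import numFieldNormedType.Exports.
Local Open Scope classical_set_scope.
Local Open Scope ring_scope.
Set Implicit Arguments.
Unset Strict Implicit.
Unset Printing Implicit Defensive.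

(** Disjoint closures give tests. For a measurable set B, a Poisson process of
    mean measure P leaves B empty with probability exp(-P(B)), so the fraction
    of the n samples that leave B empty is within O(n^(-1/2)) of exp(-P(B)),
    uniformly in P, by Chebyshev's inequality. This separates P(B) <= a from
    P(B) >= b when a < b ([separated_mass]).
    Pairs of families that tests separate are stable under finite unions on
    either side. Cutting the possible values of finitely many masses into a
    grid therefore separates families of bounded total mass on which the
    integrals of a bounded measurable function stay apart
    ([separated_integral]), because such a function is uniformly close to one
    with finitely many values. Hence every neighborhood U of a measure P
    admits a neighborhood W of P that is separated from the complement of U
    ([separated_outside]). If the closures are disjoint, every point of the
    compact closure of Theta0 thus has a neighborhood that tests separate from
    Theta1, and compactness makes finitely many of them suffice
    ([disjoint_closures_separated]).

    Tests separate the closures. For a fixed n it is enough that the law of the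
    n samples depends continuously on P along a compact set K of the topology
    of setwise convergence. The probability that the samples show prescribed
    counts on the cells of a finite measurable partition is a polynomial in the
    masses of the cells times an exponential, so it is continuous. An arbitrary
    event E is approximated by finitely many such tables of counts, but only in
    the law of one given process, so the approximation has to be transferred to
    all P in K at once. Positivity and compactness give uniform countable
    additivity on K: a limit of counterexamples would be a finite measure that
    is not continuous from above ([compact_uniformly_continuous]). This yields
    one finite measure that dominates K uniformly up to a given error
    ([compact_uniformly_dominated]), and the Hahn decomposition turns this into
    an inequality between measures after removing from each P a set of small
    mass ([compact_truncation]). When P <= nu, comparing table by table shows
    that the law under P is at most exp(n (nu(Omega) - P(Omega))) times the law
    under nu ([lawr_le]); applied to complements of events, the same inequality
    bounds the effect of removing the small set ([lawr_restr_le]). So all laws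
    with P in K are dominated, up to a small error, by a multiple of a single
    law ([law_compact_dominated]). A measure Q common to both closures would
    then be near some P0 in Theta0 and some P1 in Theta1 that give nearly the
    same probability to the rejection event of a good test, which is absurd
    ([separated_disjoint_closures]). *)

(** * Bounded measurable functions *)

Section bounded_integrals.
Context d (T : measurableType d) (R : realType).
Implicit Types (f g : T -> R) (mu : {finite_measure set T -> \bar R}).

Definition bmeas f := measurable_fun setT f /\ exists M, forall x, `|f x| <= M.

Lemma bmeas_cst (c : R) : bmeas (fun=> c).
Proof. by split; [exact: measurable_cst | exists `|c|]. Qed.

Lemma bmeas_indic A : measurable A -> bmeas \1_A.
Proof.
move=> mA; split; first exact: measurable_indic.
by exists 1 => x; rewrite indicE; case: (_ \in _); rewrite ?normr1 ?normr0.
Qed.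

Lemma bmeasD f g : bmeas f -> bmeas g -> bmeas (fun x => f x + g x).
Proof.
move=> [mf [M fM]] [mg [N gN]]; split; first exact: measurable_funD.
by exists (M + N) => x; rewrite (le_trans (ler_normD _ _))// lerD.
Qed.

Lemma bmeasM f g : bmeas f -> bmeas g -> bmeas (fun x => f x * g x).
Proof.
move=> [mf [M fM]] [mg [N gN]]; split; first exact: measurable_funM.
by exists (M * N) => x; rewrite normrM ler_pM.
Qed.

Lemma bmeas_sum (I : Type) (s : seq I) (F : I -> T -> R) :
  (forall i, bmeas (F i)) -> bmeas (fun x => \sum_(i <- s) F i x).
Proof.
move=> bF; elim: s => [|i s IH].
  by under eq_fun do rewrite big_nil; exact: bmeas_cst.
by under eq_fun do rewrite big_cons; exact: bmeasD.
Qed.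

Lemma bmeas_integrable mu f : bmeas f -> mu.-integrable setT (EFin \o f).
Proof.
move=> [mf [M fM]]; apply: measurable_bounded_integrable => //.
  by rewrite ltey_eq fin_num_measure.
exists M; split; first by rewrite num_real.
by move=> y My x _; exact: le_trans (fM x) (ltW My).
Qed.

Lemma integral_bmeasD mu f g : bmeas f -> bmeas g ->
  (\int[mu]_x (f x + g x) = \int[mu]_x f x + \int[mu]_x g x)%R.
Proof. by move=> bf bg; rewrite RintegralD//; exact: bmeas_integrable. Qed.

Lemma integral_bmeasZ mu (c : R) f : bmeas f ->
  (\int[mu]_x (c * f x) = c * \int[mu]_x f x)%R.
Proof. by move=> bf; rewrite RintegralZl//; exact: bmeas_integrable. Qed.

Lemma integral_bmeas_sum mu (I : Type) (s : seq I) (F : I -> T -> R) :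
  (forall i, bmeas (F i)) ->
  (\int[mu]_x (\sum_(i <- s) F i x) = \sum_(i <- s) \int[mu]_x F i x)%R.
Proof.
move=> bF; elim: s => [|i s IH].
  by under eq_Rintegral do rewrite big_nil; rewrite big_nil Rintegral_cst// mul0r.
under eq_Rintegral do rewrite big_cons.
by rewrite integral_bmeasD ?big_cons ?IH//; exact: bmeas_sum.
Qed.

Lemma le_integral_bmeas mu f g : bmeas f -> bmeas g ->
  (forall x, f x <= g x) -> (\int[mu]_x f x <= \int[mu]_x g x)%R.
Proof. by move=> bf bg fg; apply: le_Rintegral => //; exact: bmeas_integrable. Qed.

Lemma integral_indic_fine mu (A : set T) : measurable A ->
  (\int[mu]_x \1_A x)%R = fine (mu A).
Proof. by move=> mA; rewrite /Rintegral integral_indic// setIT. Qed.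

End bounded_integrals.

(** * Means of tests *)

Section sample_mean.
Context (R : realType) (Omega : ptopologicalType).
Variable S : forall (P : fmeas R Omega) (n : nat), poisson_sample P n.
Implicit Types P : fmeas R Omega.

Definition sample_tuple P n (w : ps_space (S P n)) :
    n.-tuple (point_measure R Omega) :=
  [tuple ps_kappa i w | i < n].

Lemma measurable_sample_tuple P n : measurable_fun setT (@sample_tuple P n).
Proof.
apply/measurable_fun_tnthP => i.
rewrite (_ : _ \o _ = ps_kappa i); first by have [] := ps_poisson (S P n) i.
by apply/funext => w /=; rewrite tnth_mktuple.
Qed.

Lemma sample_meanE P n g :
  sample_mean (S P n) g = (\int[ps_prob (S P n)]_w g (sample_tuple w))%R.
Proof. by rewrite /sample_mean unlock. Qed.

Lemma bmeas_sample P n (g : n.-tuple (point_measure R Omega) -> R) :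
  bmeas g -> bmeas (fun w : ps_space (S P n) => g (sample_tuple w)).
Proof.
move=> [mg [M gM]]; split; last by exists M => w; exact: gM.
by apply: (measurableT_comp mg); exact: measurable_sample_tuple.
Qed.

Lemma test_bmeas n (K : n.-tuple (point_measure R Omega) -> R) :
  is_test K -> bmeas K.
Proof.
move=> [mK K01]; split => //; exists 1 => x.
by have /andP[K0 K1] := K01 x; rewrite ger0_norm.
Qed.

Lemma test_compl n (K : n.-tuple (point_measure R Omega) -> R) :
  is_test K -> is_test (fun x => 1 - K x).
Proof.
move=> [mK K01]; split; first exact: measurable_funB.
by move=> x; have /andP[K0 K1] := K01 x; apply/andP; split; lra.
Qed.

Lemma test_min n (K K' : n.-tuple (point_measure R Omega) -> R) :
  is_test K -> is_test K' -> is_test (fun x => Num.min (K x) (K' x)).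
Proof.
move=> [mK K01] [mK' K01']; split; first exact: measurable_minr.
move=> x; have /andP[K0 K1] := K01 x; have /andP[K0' K1'] := K01' x.
by rewrite le_min ge_min K0 K0' K1.
Qed.

Lemma test_indic n (A : set (n.-tuple (point_measure R Omega))) :
  measurable A -> is_test (\1_A : _ -> R).
Proof.
move=> mA; split; first exact: measurable_indic.
by move=> x; rewrite indicE; case: (_ \in _); rewrite lexx ler01.
Qed.

Lemma sample_mean_le P n (g h : n.-tuple (point_measure R Omega) -> R) :
  bmeas g -> bmeas h -> (forall x, g x <= h x) ->
  sample_mean (S P n) g <= sample_mean (S P n) h.
Proof.
move=> bg bh gh; rewrite !sample_meanE; apply: le_integral_bmeas => //.
- exact: bmeas_sample.
- exact: bmeas_sample.
Qed.

Lemma sample_meanD P n (g h : n.-tuple (point_measure R Omega) -> R) :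
  bmeas g -> bmeas h ->
  sample_mean (S P n) (fun x => g x + h x) =
  sample_mean (S P n) g + sample_mean (S P n) h.
Proof.
move=> bg bh; rewrite !sample_meanE integral_bmeasD//.
- exact: bmeas_sample.
- exact: bmeas_sample.
Qed.

Lemma sample_mean_cst P n (c : R) : sample_mean (S P n) (fun=> c) = c.
Proof.
rewrite sample_meanE (_ : Rintegral _ _ _ = c * fine (ps_prob (S P n) setT)).
  by rewrite probability_setT /= mulr1.
exact: Rintegral_cst.
Qed.

Lemma sample_mean_test P n (K : n.-tuple (point_measure R Omega) -> R) :
  is_test K -> 0 <= sample_mean (S P n) K <= 1.
Proof.
move=> tK; have bK := test_bmeas tK; have [mK K01] := tK.
apply/andP; split.
  rewrite -(sample_mean_cst P n 0); apply: sample_mean_le => //.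
    exact: bmeas_cst.
  by move=> x; have /andP[] := K01 x.
rewrite -(sample_mean_cst P n 1); apply: sample_mean_le => //.
  exact: bmeas_cst.
by move=> x; have /andP[] := K01 x.
Qed.

End sample_mean.

(** * Families of measures separated by tests *)

Section separation.
Context (R : realType) (Omega : ptopologicalType).
Variable S : forall (P : fmeas R Omega) (n : nat), poisson_sample P n.
Implicit Types (P : fmeas R Omega) (A B C : set (fmeas R Omega)).
Local Notation sample_fun := (forall n, n.-tuple (point_measure R Omega) -> R).

(** The order of the quantifiers, n before P, makes this uniform over A; it
    replaces a limit of suprema, whose value on an empty A is a convention. *)
Definition uniformly_small A (K : sample_fun) :=
  forall e : R, 0 < e -> \forall n \near \oo,
    forall P, A P -> sample_mean (S P n) (K n) <= e.

Definition test_separated A B := exists K : sample_fun,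
  [/\ forall n, is_test (K n), uniformly_small A K
    & uniformly_small B (fun n x => 1 - K n x)].

(** The empty family needs care: its supremum is 0, which agrees with the
    vacuous truth of the uniform bound. *)
Lemma uniformly_small_sup A (K : sample_fun) : (forall n, is_test (K n)) ->
  uniformly_small A K <->
  (fun n => sup [set sample_mean (S P n) (K n) | P in A]) @ \oo --> (0 : R).
Proof.
move=> tK; set s := fun n => sup _.
have ub n P : A P -> sample_mean (S P n) (K n) <= s n.
  move=> AP; apply: ub_le_sup; last by exists P.
  by exists 1 => _ [Q _ <-]; have /andP[] := sample_mean_test S Q (tK n).
have s0 n : 0 <= s n.
  have [[P AP]|A0] := pselect (A !=set0).
    apply: le_trans (ub n P AP).
    by have /andP[] := sample_mean_test S P (tK n).
  rewrite /s (_ : [set _ | _ in _] = set0) ?sup0//.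
  by rewrite -subset0 => r [P AP _]; apply: A0; exists P.
split=> [small|/cvgrPdist_le cvg e e0].
  apply/cvgrPdist_le => e e0; near=> n.
  rewrite sub0r normrN ger0_norm//.
  have [A0|A0] := pselect ([set sample_mean (S P n) (K n) | P in A] !=set0).
    apply: sup_le_ub => // _ [P AP <-]; move: P AP.
    by near: n; exact: small.
  by rewrite /s sup_out ?ltW// => -[].
near=> n => P AP; apply: le_trans (ub n P AP) _.
have : `|0 - s n| <= e by near: n; exact: cvg.
by rewrite sub0r normrN ger0_norm.
Unshelve. all: by end_near. Qed.

Lemma separated_distinguishable A B :
  test_separated A B <-> distinguishable S A B.
Proof.
by split=> -[K [tK KA KB]]; exists K; split=> //;
  apply/uniformly_small_sup => // n; exact: test_compl.
Qed.

Lemma separated_sub A A' B B' : A' `<=` A -> B' `<=` B ->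
  test_separated A B -> test_separated A' B'.
Proof.
move=> AA BB [K [tK KA KB]]; exists K; split=> // e e0.
  by apply: filterS (KA e e0) => n h P /AA; exact: h.
by apply: filterS (KB e e0) => n h P /BB; exact: h.
Qed.

Lemma separated_sym A B : test_separated A B -> test_separated B A.
Proof.
move=> [K [tK KA KB]]; exists (fun n x => 1 - K n x); split=> //.
  by move=> n; exact: test_compl.
rewrite (_ : (fun _ _ => _) = K)//.
by apply: functional_extensionality_dep => n; apply/funext => x; rewrite opprB addrC subrK.
Qed.

Lemma separated0 B : test_separated set0 B.
Proof.
exists (fun _ => cst 1); split=> [n|e e0|e e0].
- by split; [exact: measurable_cst|move=> x; rewrite ler01 lexx].
- by near=> n.
- near=> n => P BP; rewrite (_ : (fun _ => _) = cst 0) ?sample_mean_cst ?ltW//.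
  by apply/funext => x /=; rewrite subrr.
Unshelve. all: by end_near. Qed.

(** The minimum of the two tests keeps both small errors of the first kind, and
    its complement is at most the sum of the two complements. *)
Lemma separatedU A A' B : test_separated A B -> test_separated A' B ->
  test_separated (A `|` A') B.
Proof.
move=> [K [tK KA KB]] [K' [tK' KA' KB']].
exists (fun n x => Num.min (K n x) (K' n x)).
have tm n := test_min (tK n) (tK' n).
split=> // e e0.
  near=> n => P [AP|AP].
    apply: (@le_trans _ _ (sample_mean (S P n) (K n))).
      apply: sample_mean_le; try exact: test_bmeas.
      by move=> x; rewrite ge_min lexx.
    by move: P AP; near: n; exact: KA.
  apply: (@le_trans _ _ (sample_mean (S P n) (K' n))).
    apply: sample_mean_le; try exact: test_bmeas.
    by move=> x; rewrite ge_min lexx orbT.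
  by move: P AP; near: n; exact: KA'.
have e20 : 0 < e / 2 by rewrite divr_gt0.
near=> n => P BP.
apply: (@le_trans _ _ (sample_mean (S P n) (fun x => (1 - K n x) + (1 - K' n x)))).
  apply: sample_mean_le.
  - exact/test_bmeas/test_compl.
  - by apply: bmeasD; exact/test_bmeas/test_compl.
  - move=> x; have [_ /(_ x)/andP[K0 K1]] := tK n.
    by have [_ /(_ x)/andP[K0' K1']] := tK' n; rewrite /Num.min; case: ifP; lra.
rewrite sample_meanD; [|exact/test_bmeas/test_compl|exact/test_bmeas/test_compl].
rewrite [leRHS](splitr e); apply: lerD; move: P BP; near: n.
  exact: KB.
exact: KB'.
Unshelve. all: by end_near. Qed.

Lemma separated_bigU (I : finType) (A : I -> set (fmeas R Omega)) B :
  (forall i, test_separated (A i) B) -> test_separated (\bigcup_i A i) B.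
Proof.
move=> sA; have : test_separated [set P | exists2 i, i \in enum I & A i P] B.
  elim: (enum I) => [|i s IH].
    by apply: separated_sub (separated0 B) => // P [].
  apply: separated_sub (separatedU (sA i) IH) => // P [k].
  by rewrite inE => /predU1P[->|ks] Ak; [left|right; exists k].
by apply: separated_sub => // P [i _ AP]; exists i; rewrite ?mem_enum.
Qed.

End separation.

(** * Testing by the frequency of empty samples *)

Section frequency.
Context d (X : measurableType d) (R : realType) (Pr : probability X R).

(** After expanding the square, pairwise independence kills the off-diagonal
    terms, and each diagonal term is p - p^2. *)
Lemma frequency_variance n (E : 'I_n -> set X) (p : R) :
  0 <= p -> (forall i, measurable (E i)) -> (forall i, Pr (E i) = p%:E) ->
  (forall i j, i != j -> Pr (E i `&` E j) = (p * p)%:E) ->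
  (\int[Pr]_w ((\sum_(i < n) (\1_(E i) w - p)) ^+ 2) <= n%:R)%R.
Proof.
move=> p0 mE PE PEE.
pose Y i j w : R := \1_(E i `&` E j) w + ((- p) * \1_(E i) w + ((- p) * \1_(E j) w + p * p)).
have YE i j w : Y i j w = (\1_(E i) w - p) * (\1_(E j) w - p).
  by rewrite /Y indicI/=; ring.
have bind i : bmeas (\1_(E i) : X -> R) by exact: bmeas_indic.
have bindp i : bmeas (fun w => - p * (\1_(E i) : X -> R) w).
  by apply: bmeasM => //; exact: bmeas_cst.
have bcst := @bmeas_cst _ X R.
have bY i j : bmeas (Y i j).
  rewrite /Y; apply: bmeasD; first by apply: bmeas_indic; exact: measurableI.
  by apply: bmeasD => //; apply: bmeasD.
have intY i j : (\int[Pr]_w Y i j w)%R = fine (Pr (E i `&` E j)) - p * p.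
  have mEE : measurable (E i `&` E j) by exact: measurableI.
  rewrite integral_bmeasD; [|exact: bmeas_indic|].
    rewrite integral_bmeasD//; last exact: bmeasD.
    rewrite integral_bmeasD// !integral_bmeasZ// !integral_indic_fine//.
    rewrite (_ : Rintegral _ _ (fun=> p) = p * fine (Pr setT)); last exact: Rintegral_cst.
    have -> : fine (Pr (E i)) = p by rewrite PE.
    have -> : fine (Pr (E j)) = p by rewrite PE.
    by rewrite probability_setT /=; ring.
  by apply: bmeasD => //; exact: bmeasD.
have -> : (\int[Pr]_w ((\sum_(i < n) (\1_(E i) w - p)) ^+ 2))%R =
          (\int[Pr]_w \sum_(i < n) \sum_(j < n) Y i j w)%R.
  apply: eq_Rintegral => w _; rewrite expr2 mulr_suml.
  apply: eq_bigr => i _; rewrite mulr_sumr; apply: eq_bigr => j _.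
  by rewrite YE.
rewrite integral_bmeas_sum; last by move=> i; exact: bmeas_sum.
rewrite -[n in n%:R]card_ord -sum1_card natr_sum; apply: ler_sum => i _.
rewrite integral_bmeas_sum// (bigD1 i)//= big1 => [|j ji].
  rewrite addr0 intY setIid PE /=.
  have : (p%:E <= 1)%E by rewrite -(PE i); exact: probability_le1.
  by rewrite lee_fin => p1; nra.
by rewrite intY PEE 1?eq_sym//= subrr.
Qed.

End frequency.

Section void_test.
Context (R : realType) (Omega : ptopologicalType).
Variable S : forall (P : fmeas R Omega) (n : nat), poisson_sample P n.

Definition no_point (B : set (borel Omega)) : set (point_measure R Omega) :=
  [set kappa | kappa B = 0%E].

Lemma measurable_count (B : set (borel Omega)) (Y : set (\bar R)) :
  measurable B -> measurable Y ->
  measurable [set kappa : point_measure R Omega | Y (kappa B)].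
Proof.
by move=> mB mY; apply: sub_sigma_algebra; exists B => //; exists Y; rewrite ?setTI.
Qed.

Lemma measurable_no_point B : measurable B -> measurable (no_point B).
Proof. by move=> mB; exact: (measurable_count mB (emeasurable_set1 0%E)). Qed.

Definition no_point_freq B n (x : n.-tuple (point_measure R Omega)) : R :=
  n%:R^-1 * \sum_(i < n) \1_(no_point B) (tnth x i).

Lemma measurable_no_point_freq B n : measurable B ->
  measurable_fun setT (@no_point_freq B n).
Proof.
move=> mB; apply: measurable_funM; first exact: measurable_cst.
apply: measurable_sum => i.
have mI : measurable_fun setT (\1_(no_point B) : _ -> R).
  by apply: measurable_indic; exact: measurable_no_point.
exact: (measurableT_comp mI (measurable_tnth i)).
Qed.

(** Chebyshev's inequality: a test that only rejects when the frequency is off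
    by eta is pointwise at most the square of the deviation over eta^2. *)
Lemma no_point_freq_dev (P : fmeas R Omega) B n (eta : R)
    (g : n.-tuple (point_measure R Omega) -> R) :
  measurable B -> (0 < n)%N -> 0 < eta -> is_test g ->
  (forall x, g x = 0 \/
     (g x = 1 /\ eta <= `|no_point_freq B x - expR (- fine (P B))|)) ->
  sample_mean (S P n) g <= (n%:R * eta ^+ 2)^-1.
Proof.
move=> mB n0 eta0 tg gE; set p := expR (- fine (P B)).
have mZ := measurable_no_point mB.
have nR0 : 0 < n%:R :> R by rewrite ltr0n.
pose E i := ps_kappa (p := S P n) i @^-1` no_point B.
have mk i : measurable_fun setT (ps_kappa (p := S P n) i).
  by have [] := ps_poisson (S P n) i.
have mE i : measurable (E i) by rewrite -[E i]setTI; exact: mk.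
have PE i : ps_prob (S P n) (E i) = p%:E.
  have [_ /(_ B 0%N mB) + _] := ps_poisson (S P n) i.
  by rewrite expr0 fact0 mulr1 divr1.
have PEE i j : i != j -> ps_prob (S P n) (E i `&` E j) = (p * p)%:E.
  move=> ij.
  pose A k := if (k == i) || (k == j) then no_point B else setT.
  have mA k : measurable (A k) by rewrite /A; case: ifP.
  have := @ps_indep _ _ P n (S P n) A mA.
  rewrite (bigD1 i)//= (bigD1 j) 1?eq_sym//= big1; last first.
    move=> k /andP[ki kj]; rewrite /A (negbTE ki) (negbTE kj) preimage_setT.
    by rewrite probability_setT.
  rewrite {2 3}/A !eqxx orbT /= -![_ @^-1` _]/(E _) !PE /= mulr1 => <-.
  rewrite fineK ?fin_num_measure//; last first.
    apply: fin_bigcap_measurable => // k _.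
    by rewrite -[X in measurable X]setTI; exact: mk.
  congr (ps_prob _ _); apply/seteqP; split=> w.
    by move=> [Ei Ej] k _; rewrite /A; case: ifP => // /orP[]/eqP ->.
  by move=> h; split; [have := h i I|have := h j I]; rewrite /A/= ?eqxx ?orbT.
have var := frequency_variance (expR_ge0 _) mE PE PEE.
pose h w : R := (n%:R * eta)^-2 * (\sum_(i < n) (\1_(E i) w - p)) ^+ 2.
rewrite sample_meanE.
have bsum : bmeas (fun w => (\sum_(i < n) (\1_(E i) w - p)) ^+ 2).
  under eq_fun do rewrite expr2.
  have b1 : bmeas (fun w => \sum_(i < n) (\1_(E i) w - p)).
    by apply: bmeas_sum => i; apply: bmeasD; [exact: bmeas_indic|exact: bmeas_cst].
  exact: bmeasM.
apply: (@le_trans _ _ (\int[ps_prob (S P n)]_w h w)%R).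
  apply: le_integral_bmeas.
  - by apply: bmeas_sample; exact: test_bmeas.
  - by apply: bmeasM => //; exact: bmeas_cst.
  - move=> w; have [->|[-> dev]] := gE (sample_tuple w).
      by rewrite mulr_ge0 ?sqr_ge0// invr_ge0 sqr_ge0.
    have devE : no_point_freq B (sample_tuple w) - p =
        n%:R^-1 * \sum_(i < n) (\1_(E i) w - p).
      rewrite /no_point_freq sumrB sumr_const card_ord -[p *+ n]mulr_natl.
      rewrite mulrBr mulrA mulVf ?gt_eqF// mul1r; congr (_ * _ - _).
      by apply: eq_bigr => i _; rewrite tnth_mktuple.
    move: dev; rewrite devE normrM gtr0_norm ?invr_gt0// ler_pdivlMl// => dev.
    rewrite /h mulrC ler_pdivlMr ?exprn_gt0 ?mulr_gt0// mul1r -[leRHS]real_normK ?num_real//.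
    by rewrite lerXn2r ?nnegrE// ltW ?mulr_gt0.
rewrite /h integral_bmeasZ//; apply: le_trans (ler_wpM2l _ var) _.
  by rewrite invr_ge0 sqr_ge0.
rewrite le_eqVlt; apply/orP; left; apply/eqP; field.
by rewrite !gt_eqF.
Qed.

Lemma inv_natM_small (c e : R) : 0 < c -> 0 < e ->
  \forall n \near \oo, (0 < n)%N /\ (n%:R * c)^-1 <= e.
Proof.
move=> c0 e0; near=> n; have n0 : (0 < n)%N by near: n; exact: nbhs_infty_gt.
split=> //; rewrite -[e]invrK lef_pV2 ?posrE ?invr_gt0 ?mulr_gt0 ?ltr0n//.
by rewrite -ler_pdivrMr//; near: n; exact: nbhs_infty_ger.
Unshelve. all: by end_near. Qed.

(** Void probabilities are strictly decreasing in the mass, so thresholding the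
    frequency of empty samples halfway between exp(-b) and exp(-a) works.
    Indicators of void events are bounded, so the deviation bound is uniform
    over all masses, however large. *)
Lemma separated_mass B (a b : R) : measurable B -> a < b ->
  test_separated S [set P | fine (P B) <= a] [set P | b <= fine (P B)].
Proof.
move=> mB ab.
have eab : expR (- b) < expR (- a) by rewrite ltr_expR ltrN2.
pose eta := (expR (- a) - expR (- b)) / 2.
pose mid := expR (- b) + eta.
have eta0 : 0 < eta by rewrite divr_gt0// subr_gt0.
have mV n : measurable [set x : n.-tuple (point_measure R Omega) |
    no_point_freq B x < mid].
  have := @measurable_no_point_freq B n mB measurableT _ (measurable_itv `]-oo, mid[).
  by rewrite setTI; congr measurable; apply/seteqP; split => x /=; rewrite in_itv.
pose K n (x : n.-tuple (point_measure R Omega)) : R :=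
  \1_[set x | no_point_freq B x < mid] x.
have tK n : is_test (K n) by exact: test_indic.
exists K; split=> // e e0.
  near=> n => P /= Pa.
  have [n0 ne] : (0 < n)%N /\ (n%:R * eta ^+ 2)^-1 <= e.
    by near: n; apply: inv_natM_small => //; rewrite exprn_gt0.
  apply: le_trans ne; apply: (@no_point_freq_dev P B) => // x.
  rewrite /K indicE; case: (boolP (x \in _)) => [|_]; last by left.
  rewrite inE /= => xm; right; split=> //.
  have pa : expR (- a) <= expR (- fine (P B)) by rewrite ler_expR lerN2.
  rewrite ler0_norm; last by move: xm; rewrite /mid /eta; lra.
  by move: xm; rewrite /mid /eta; lra.
near=> n => P /= Pb.
have [n0 ne] : (0 < n)%N /\ (n%:R * eta ^+ 2)^-1 <= e.
  by near: n; apply: inv_natM_small => //; rewrite exprn_gt0.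
apply: le_trans ne; apply: (@no_point_freq_dev P B) => //.
  exact: test_compl.
move=> x; rewrite /K indicE; case: (boolP (x \in _)) => [_|]; first by left; rewrite subrr.
rewrite notin_setE /= => /negP; rewrite -leNgt => xm; right; rewrite subr0; split=> //.
have pb : expR (- fine (P B)) <= expR (- b) by rewrite ler_expR lerN2.
rewrite ger0_norm; last by move: xm; rewrite /mid /eta; lra.
by move: xm; rewrite /mid /eta; lra.
Unshelve. all: by end_near. Qed.

End void_test.

(** * Separation by finitely many masses and by integrals *)

Section separation_by_integrals.
Context (R : realType) (Omega : ptopologicalType).
Variable S : forall (P : fmeas R Omega) (n : nat), poisson_sample P n.

(** The vector of masses lives in a bounded box, cut into finitely many cells of
    side eta / 2. Two cells that meet W and V respectively must differ by at
    least two steps in some coordinate, which leaves a gap that a single mass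
    test detects. *)
Lemma separated_masses (I : finType) (B : I -> set (borel Omega))
    (W V : set (fmeas R Omega)) (L eta : R) :
  (forall i, measurable (B i)) -> 0 < eta ->
  (forall P i, (W `|` V) P -> fine (P (B i)) <= L) ->
  (forall P Q, W P -> V Q -> exists i, eta <= `|fine (P (B i)) - fine (Q (B i))|) ->
  test_separated S W V.
Proof.
move=> mB eta0 WVL gap; pose h := eta / 2; have h0 : 0 < h by rewrite divr_gt0.
pose N := (Num.truncn (L / h)).+1.
pose cell (g : {ffun I -> 'I_N}) : set (fmeas R Omega) :=
  [set P | forall i, (g i)%:R * h <= fine (P (B i)) < (g i).+1%:R * h].
have incell (U : set (fmeas R Omega)) : (forall P i, U P -> fine (P (B i)) <= L) ->
    U `<=` \bigcup_g (U `&` cell g).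
  move=> UL P UP; exists [ffun i => inord (Num.truncn (fine (P (B i)) / h))] => //.
  split=> // i; have PB0 : 0 <= fine (P (B i)) / h.
    by rewrite divr_ge0 ?fine_ge0// ltW.
  have /andP[lo hi] := truncn_itv PB0.
  rewrite ffunE inordK; first by rewrite -ler_pdivlMr// lo -ltr_pdivrMr.
  by rewrite ltnS le_truncn// ler_pM2r ?invr_gt0// UL.
apply: (@separated_sub _ _ _ (\bigcup_g (W `&` cell g)) _ (\bigcup_g (V `&` cell g))).
- by apply: incell => P i WP; apply: WVL; left.
- by apply: incell => P i VP; apply: WVL; right.
apply: separated_bigU => g; apply/separated_sym/separated_bigU => g'.
apply: separated_sym.
(* A difference of one step is not enough: adjacent cells touch. *)
have [[i gg]|] := pselect (exists i, ((g i).+1 < g' i)%N).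
  have lt : (g i).+1%:R * h < (g' i)%:R * h by rewrite ltr_pM2r// ltr_nat.
  apply: separated_sub (separated_mass S (mB i) lt) => P [_ /(_ i)/andP[? ?]] //=.
  exact: ltW.
have [[i gg] _|] := pselect (exists i, ((g' i).+1 < g i)%N).
  have lt : (g' i).+1%:R * h < (g i)%:R * h by rewrite ltr_pM2r// ltr_nat.
  apply: separated_sym.
  apply: separated_sub (separated_mass S (mB i) lt) => P [_ /(_ i)/andP[? ?]] //=.
  exact: ltW.
move=> gg1 gg2.
have [[P [WP cP]]|W0] := pselect (exists P, (W `&` cell g) P); last first.
  by apply: separated_sub (separated0 S (V `&` cell g')) => // P WP; apply: W0; exists P.
apply/separated_sym; apply: separated_sub (separated0 S (W `&` cell g)) => // Q [VQ cQ].
have [i] := gap _ _ WP VQ; apply/negP; rewrite -ltNge ltr_norml.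
have /andP[P1 P2] := cP i; have /andP[Q1 Q2] := cQ i.
have g1 : ((g i)%:R : R) <= (g' i)%:R + 1.
  by rewrite natr1 ler_nat leqNgt; apply/negP => ?; apply: gg1; exists i.
have g2 : ((g' i)%:R : R) <= (g i)%:R + 1.
  by rewrite natr1 ler_nat leqNgt; apply/negP => ?; apply: gg2; exists i.
have E : eta = 2 * h by rewrite /h mulrCA divff ?mulr1.
rewrite -natr1 in P2; rewrite -natr1 in Q2.
by rewrite E; apply/andP; split; nra.
Qed.

(** Round the values of f down to a grid of step e. *)
Lemma label_approx (f : borel Omega -> R) (e : R) : bmeas f -> 0 < e ->
  exists (N : nat) (b : borel Omega -> 'I_N) (c : 'I_N -> R),
    (forall i, measurable (b @^-1` [set i])) /\
    (forall x, `|f x - c (b x)| <= e).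
Proof.
move=> [mf [M fM]] e0.
pose t x := Num.truncn ((f x + M) / e).
have t0 x : 0 <= (f x + M) / e.
  by rewrite divr_ge0 ?(ltW e0)//; have := fM x; rewrite ler_norml; lra.
pose N := (Num.truncn ((M + M) / e)).+1.
have tN x : (t x < N)%N.
  rewrite ltnS le_truncn// ler_pM2r ?invr_gt0//.
  by have := fM x; rewrite ler_norml; lra.
have tP x (i : nat) : t x = i <-> i%:R * e - M <= f x < i.+1%:R * e - M.
  split=> [<-|/andP[lo hi]].
    have /andP[lo hi] := truncn_itv (t0 x).
    rewrite ler_pdivlMr// in lo; rewrite ltr_pdivrMr// in hi.
    by apply/andP; split; rewrite /t; lra.
  apply: truncn_def; rewrite ler_pdivlMr// ltr_pdivrMr//; apply/andP; split; lra.
exists N, (fun x => inord (t x)), (fun i => i%:R * e - M); split=> [i|x].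
  rewrite (_ : _ @^-1` _ = f @^-1` `[i%:R * e - M, i.+1%:R * e - M[).
    rewrite -[X in measurable X]setTI; apply: mf => //.
  apply/seteqP; split=> x /=; rewrite in_itv/=.
    by move=> <-; apply/tP; rewrite inordK.
  by move=> /tP ti; apply/val_inj; rewrite /= inordK ti.
rewrite inordK//; have /andP[lo hi] := (tP x (t x)).1 erefl.
rewrite -natr1 in hi.
by rewrite ler_norml; apply/andP; split; nra.
Qed.

Lemma fint_label_approx (f : borel Omega -> R) (e : R) N
    (b : borel Omega -> 'I_N) (c : 'I_N -> R) (P : fmeas R Omega) :
  bmeas f -> (forall i, measurable (b @^-1` [set i])) ->
  (forall x, `|f x - c (b x)| <= e) ->
  `|fint f P - \sum_i c i * fine (P (b @^-1` [set i]))| <= e * fine (P setT).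
Proof.
move=> bf mb fcb.
pose g x := \sum_i c i * (\1_(b @^-1` [set i]) : _ -> R) x.
have bterm i : bmeas (fun x => c i * (\1_(b @^-1` [set i]) : _ -> R) x).
  by apply: bmeasM; [exact: bmeas_cst|exact: bmeas_indic].
have bg : bmeas g by exact: bmeas_sum.
have gE x : g x = c (b x).
  rewrite /g (bigD1 (b x))//= big1 => [|i ib].
    by rewrite indicE mem_set// mulr1 addr0.
  by rewrite indicE memNset ?mulr0//= => bi; rewrite bi eqxx in ib.
have <- : fint g P = \sum_i c i * fine (P (b @^-1` [set i])).
  rewrite /fint integral_bmeas_sum//; apply: eq_bigr => i _.
  by rewrite integral_bmeasZ ?integral_indic_fine//; exact: bmeas_indic.
have key (u v : borel Omega -> R) : bmeas u -> bmeas v ->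
    (forall x, u x <= v x + e) -> fint u P <= fint v P + e * fine (P setT).
  move=> bu bv uv.
  have -> : fint v P + e * fine (P setT) = (\int[P]_x (v x + e))%R.
    rewrite integral_bmeasD//; last exact: bmeas_cst.
    by congr (_ + _); rewrite -Rintegral_cst.
  by apply: le_integral_bmeas => //; apply: bmeasD => //; exact: bmeas_cst.
have fg x : `|f x - g x| <= e by rewrite gE.
have h1 : fint f P <= fint g P + e * fine (P setT).
  by apply: key => // x; have := fg x; rewrite ler_norml; lra.
have h2 : fint g P <= fint f P + e * fine (P setT).
  by apply: key => // x; have := fg x; rewrite ler_norml; lra.
by rewrite ler_norml; apply/andP; split; lra.
Qed.

(** Replacing f by a function with finitely many values changes each integral
    by at most e / 4 when the total mass is bounded, so the integrals of the
    simple function still differ by e / 2 and one of its level sets must have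
    clearly different masses. *)
Lemma separated_integral (f : borel Omega -> R) (W V : set (fmeas R Omega))
    (L e : R) : bmeas f -> 0 < e ->
  (forall P, (W `|` V) P -> fine (P setT) <= L) ->
  (forall P Q, W P -> V Q -> e <= `|fint f P - fint f Q|) ->
  test_separated S W V.
Proof.
move=> bf e0 WVL gap.
pose L' := `|L| + 1; have L'0 : 0 < L' by rewrite ltr_pwDr.
have LL' : L <= L' by rewrite (le_trans (ler_norm L))// lerDl.
pose dl := e / (4 * L'); have dl0 : 0 < dl by rewrite divr_gt0// mulr_gt0.
have [N [b [c [mb fcb]]]] := label_approx bf dl0.
pose C := \sum_i `|c i| + 1; have C0 : 0 < C by rewrite ltr_pwDr// sumr_ge0.
pose eta := e / (2 * C); have eta0 : 0 < eta by rewrite divr_gt0// mulr_gt0.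
apply: (@separated_masses _ (fun i => b @^-1` [set i]) W V L eta) => //.
  move=> P i WVP; apply: le_trans (WVL P WVP); apply: fine_le.
  - exact: fin_num_measure.
  - exact: fin_num_measure.
  - by apply: le_measure; rewrite ?inE.
move=> P Q WP VQ; apply/not_existsP => nogap.
have P1 := fint_label_approx P bf mb fcb.
have Q1 := fint_label_approx Q bf mb fcb.
have PL : dl * fine (P setT) <= e / 4.
  have -> : e / 4 = dl * L' by rewrite /dl; field; rewrite gt_eqF.
  by rewrite ler_pM2l// (le_trans (WVL P _))//; left.
have QL : dl * fine (Q setT) <= e / 4.
  have -> : e / 4 = dl * L' by rewrite /dl; field; rewrite gt_eqF.
  by rewrite ler_pM2l// (le_trans (WVL Q _))//; right.
have := gap _ _ WP VQ; apply/negP; rewrite -ltNge.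
set sP := \sum_i _ in P1; set sQ := \sum_i _ in Q1.
have sPQ : `|sP - sQ| < e / 2.
  rewrite -sumrB; apply: (@le_lt_trans _ _ (\sum_i `|c i| * eta)).
    apply: le_trans (ler_norm_sum _ _ _) _; apply: ler_sum => i _.
    rewrite -mulrBr normrM ler_wpM2l// ltW// ltNge; apply/negP.
    exact: nogap.
  rewrite -mulr_suml (_ : e / 2 = C * eta); first by rewrite ltr_pM2r// ltrDl.
  by rewrite /eta; field; rewrite gt_eqF.
move: P1 Q1 sPQ; rewrite !ler_norml !ltr_norml.
by move=> /andP[? ?] /andP[? ?] /andP[? ?]; apply/andP; split; lra.
Qed.

End separation_by_integrals.

(** * Topologies generated by integrals *)

Section tau_topology.
Context (R : realType) (Omega : ptopologicalType).
Implicit Types (Psi : set (borel Omega -> R)) (P : fmeas R Omega).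

(** The supremum topology is finer than each of the initial topologies. *)
Lemma fint_continuous Psi f : Psi f -> continuous (fint f : tau_space Psi -> R).
Proof.
move=> Pf P; have := @cvg_sup _ _ (fun f : {f | Psi f} =>
    Topological.class (initial_topology (fint (sval f)) : topologicalType))
    (nbhs (P : tau_space Psi)) P _.
move=> [/(_ (@cvg_id _ _))/(_ (exist _ f Pf)) cvgP _] A.
have := @initial_continuous _ _ (fint f) P A.
move=> h nA; exact: (cvgP _ (h nA)).
Qed.

(** This lets the separation argument treat one integral at a time, instead of
    the finite intersections that form a base of the topology. *)
Lemma tau_cvg Psi (F : set_system (fmeas R Omega)) P : Filter F ->
  (forall f, Psi f -> forall e, 0 < e ->
     F [set Q | `|fint f Q - fint f P| < e]) ->
  F --> (P : tau_space Psi).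
Proof.
move=> FF Fe; apply/cvg_sup => -[f Pf] A nA.
have : nbhs (P : initial_topology (fint f)) A by exact: nA.
rewrite nbhsE => -[_ [[U oU <-] UP] sUA].
have : nbhs (fint f P) U by exact: open_nbhs_nbhs.
rewrite -nbhs_ballE => -[e /= e0 eU].
apply: filterS (Fe f Pf e e0) => Q PQ; apply: sUA; apply: eU.
by rewrite /ball/= distrC.
Qed.

End tau_topology.

(** * From disjoint closures to tests *)

Section closures_to_tests.
Context (R : realType) (Omega : ptopologicalType).
Variable S : forall (P : fmeas R Omega) (n : nat), poisson_sample P n.

(** Measures of large total mass are handled apart: they are separated from W by
    their mass alone, so that the comparison of integrals only concerns families
    of bounded mass. *)
Lemma separated_nbhs Psi (P : fmeas R Omega) (f : borel Omega -> R) (e : R) :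
  Psi f -> Psi (cst 1) -> bmeas f -> 0 < e ->
  exists2 W, nbhs (P : tau_space Psi) W &
    test_separated S W [set Q | e <= `|fint f Q - fint f P|].
Proof.
move=> Pf P1 bf e0; pose L := fine (P setT) + 1.
have massE Q : fint (cst 1) Q = fine (Q setT) by rewrite /fint Rintegral_cst// mul1r.
exists [set Q | `|fint f Q - fint f P| < e / 2 /\ fine (Q setT) < L].
  have e20 : 0 < e / 2 by rewrite divr_gt0.
  have /cvgrPdist_lt n1 : fint f @ nbhs (P : tau_space Psi) --> fint f P.
    exact: fint_continuous.
  have /cvgrPdist_lt n2 :
      fint (cst 1) @ nbhs (P : tau_space Psi) --> fint (cst 1) P.
    exact: fint_continuous.
  near=> Q; have h1 : `|fint f P - fint f Q| < e / 2 by near: Q; exact: n1.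
  have h2 : `|fint (cst 1) P - fint (cst 1) Q| < 1 by near: Q; exact: n2.
  split.
    by rewrite distrC.
  by move: h2; rewrite !massE ltr_norml /L => /andP[]; lra.
set W := (X in test_separated S X _).
pose V1 := [set Q : fmeas R Omega | L + 1 <= fine (Q setT)].
pose V2 := [set Q : fmeas R Omega | e <= `|fint f Q - fint f P| /\ fine (Q setT) <= L + 1].
have s1 : test_separated S W V1.
  apply: separated_sub (@separated_mass _ _ S setT L (L + 1) _ _) => //.
  - by move=> Q [_ /ltW].
  - by rewrite ltrDl.
have s2 : test_separated S W V2.
  have e20 : 0 < e / 2 by rewrite divr_gt0.
  apply: (@separated_integral _ _ S f W V2 (L + 1) (e / 2)) => //.
    by move=> Q [[_ /ltW QL]|[]//]; rewrite (le_trans QL)// lerDl.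
  move=> Q Q' [QW _] [Q'V _]; have := ler_distD (fint f Q) (fint f Q') (fint f P).
  by rewrite (distrC (fint f Q')  (fint f Q)); lra.
have := separated_sym (separatedU (separated_sym s1) (separated_sym s2)).
apply: separated_sub => // Q /= Qe.
by have [?|/ltW ?] := leP (L + 1) (fine (Q setT)); [left|right].
Unshelve. all: by end_near. Qed.

(** The sets U having this property form a filter, because separation is stable
    under unions; by [separated_nbhs] every integral converges along it to its
    value at P, so the filter converges to P. *)
Lemma separated_outside Psi (P : fmeas R Omega) (U : set (fmeas R Omega)) :
  Psi (cst 1) -> (forall f, Psi f -> bmeas f) ->
  nbhs (P : tau_space Psi) U ->
  exists2 W, nbhs (P : tau_space Psi) W & test_separated S W (~` U).
Proof.
move=> P1 bPsi.
pose F : set_system (fmeas R Omega) := [set U |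
  exists2 W, nbhs (P : tau_space Psi) W & test_separated S W (~` U)].
have FF : Filter F.
  split.
  - exists setT; first exact: filterT.
    by rewrite setCT; apply: separated_sym; exact: separated0.
  - move=> A B [W nW sW] [W' nW' sW']; exists (W `&` W'); first exact: filterI.
    rewrite setCI; apply/separated_sym/separatedU; apply/separated_sym.
      by apply: separated_sub sW => // Q [].
    by apply: separated_sub sW' => // Q [].
  - move=> A B AB [W nW sW]; exists W => //.
    by apply: separated_sub sW => //; exact: subsetC.
suff : F --> (P : tau_space Psi) by exact.
apply: tau_cvg => f Pf e e0.
have [W nW sW] := separated_nbhs P Pf P1 (bPsi f Pf) e0.
exists W => //; apply: separated_sub sW => // Q /= /negP.
by rewrite -leNgt.
Qed.

(** Otherwise the sets U for which A minus U is separated from B form a proper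
    filter containing the closure of A. A cluster point P of it has a
    neighborhood W separated from B, so the complement of W is in the filter;
    but it does not meet W. *)
Lemma disjoint_closures_separated Psi (A B : set (fmeas R Omega)) :
  Psi (cst 1) -> (forall f, Psi f -> bmeas f) ->
  precompact (A : set (tau_space Psi)) ->
  closure (A : set (tau_space Psi)) `&` closure (B : set (tau_space Psi)) = set0 ->
  test_separated S A B.
Proof.
move=> P1 bPsi; rewrite precompactE => cA AB0; apply: contrapT => nAB.
pose F : set_system (tau_space Psi) := [set U | test_separated S (A `\` U) B].
have FF : ProperFilter F.
  apply: Build_ProperFilter_ex.
    move=> U FU; apply/set0P/eqP => U0; apply: nAB.
    by move: FU; rewrite /F /= U0 setD0.
  split.
  - by rewrite /F/= setDT; exact: separated0.
  - move=> U V FU FV; rewrite /F/= setDIr.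
    exact: separatedU.
  - move=> U V UV; apply: separated_sub => //.
    by move=> P [AP VP]; split=> // /UV.
have FcA : F (closure (A : set (tau_space Psi))).
  apply: separated_sub (separated0 S B) => // P [AP]; apply.
  exact: subset_closure.
have [P [PA clP]] := cA F FF FcA.
have [U nU UB] : exists2 U, nbhs (P : tau_space Psi) U & U `&` B = set0.
  have : ~ closure (B : set (tau_space Psi)) P.
    by move=> PB; rewrite -[False]/(set0 P) -AB0.
  move=> /existsNP[U /not_implyP[nU /set0P/negP]]; rewrite negbK => /eqP BU.
  by exists U => //; rewrite setIC.
have [W nW sW] := separated_outside P1 bPsi nU.
have FW : F (~` W).
  apply: separated_sub sW; first by move=> Q [_ /contrapT].
  by move=> Q BQ UQ; rewrite -[False]/(set0 Q) -UB.
by have [Q []] := clP _ _ FW nW.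
Qed.

Lemma open_measurable_borel (U : set Omega) : open U ->
  measurable (U : set (borel Omega)).
Proof. by move=> oU; exact: sub_sigma_algebra. Qed.

Lemma bounded_bmeas (f : borel Omega -> R) :
  measurable_fun setT f -> [bounded (f x : R^o) | x in setT] -> bmeas f.
Proof.
move=> mf [M [_ bM]]; split => //; exists (M + 1) => x.
by apply: bM => //; rewrite ltrDl.
Qed.

(** The only facts about the three topologies that the argument uses. *)
Lemma tau_choice_bmeas (Psi : set (borel Omega -> R)) :
  [set @bounded_continuous R Omega; @borel_indicators R Omega;
       @bounded_measurable R Omega] Psi ->
  Psi (cst 1) /\ (forall f, Psi f -> bmeas f).
Proof.
have b1 : [bounded (cst 1 x : R^o) | x in [set: borel Omega]].
  exists 1; split; first by rewrite num_real.
  by move=> M /ltW M1 x _ /=; rewrite normr1.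
case=> [[|]|] ->.
- split=> [|f [cf bf]]; first by split=> //; exact: cst_continuous.
  apply: bounded_bmeas => //; apply: (measurability _ (RGenOpens.measurableE R)).
  move=> _ [_ [a [b ->]] <-]; rewrite setTI; apply: open_measurable_borel.
  by move/continuousP : cf; apply; exact: interval_open.
- split=> [|_ [B mB <-]]; last exact: bmeas_indic.
  by exists setT => //; rewrite indicT.
- split=> [|f [mf bf]]; first by split=> //; exact: measurable_cst.
  exact: bounded_bmeas.
Qed.

End closures_to_tests.

(** * Operations on finite measures *)

Section finite_measure_sum.
Context d (T : measurableType d) (R : realType).
Variables m1 m2 : {finite_measure set T -> \bar R}.

Definition finite_add : set T -> \bar R := measure_add m1 m2.

HB.instance Definition _ := Measure.on finite_add.

Let finite_add_fin : fin_num_fun finite_add.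
Proof.
by move=> A mA; rewrite /finite_add measure_addE fin_numD !fin_num_measure.
Qed.

HB.instance Definition _ :=
  @Measure_isFinite.Build _ _ _ finite_add finite_add_fin.

Lemma finite_addE A : finite_add A = (m1 A + m2 A)%E.
Proof. exact: measure_addE. Qed.

End finite_measure_sum.

Section finite_measure_operations.
Context (R : realType) (Omega : ptopologicalType).

Definition fmeas_add (P Q : fmeas R Omega) : fmeas R Omega := finite_add P Q.

Definition fmeas_scale (c : {nonneg R}) (P : fmeas R Omega) : fmeas R Omega :=
  mscale c P.

Definition fmeas_restr (P : fmeas R Omega) (D : set (borel Omega))
  (mD : measurable D) : fmeas R Omega := mrestr P mD.

Lemma fmeas_addE P Q A : fmeas_add P Q A = (P A + Q A)%E.
Proof. exact: finite_addE. Qed.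

Lemma fmeas_scaleE c P A : fmeas_scale c P A = (c%:num%:E * P A)%E.
Proof. by []. Qed.

Lemma fmeas_restrE P D (mD : measurable D) A :
  fmeas_restr P mD A = P (A `&` D).
Proof. by []. Qed.

End finite_measure_operations.

(** * Domination on compact sets of measures *)

Section tau_compactness.
Context (R : realType) (Omega : ptopologicalType).
Local Notation tau := (tau_space (@borel_indicators R Omega)).
Implicit Types (P nu : fmeas R Omega) (A D : set (borel Omega)) (K : set tau).

Lemma mass_continuous A : measurable A ->
  continuous (fun P : tau => fine (P A)).
Proof.
move=> mA; rewrite (_ : (fun P : tau => fine (P A)) = fint (\1_A : borel Omega -> R)).
  by apply: fint_continuous; exists A.
by apply/funext => P; exact/esym/integral_indic_fine.
Qed.

Lemma mass_ge_closed A : measurable A -> forall e : R,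
  closed [set P : tau | e <= fine (P A)].
Proof.
move=> mA e; apply: (closed_comp (f := fun P : tau => fine (P A)) (D := [set x | e <= x])).
  by move=> P _; exact: mass_continuous.
exact: closed_ge.
Qed.

Lemma compact_mass_bounded K : compact K ->
  exists M : R, forall P, K P -> fine (P setT) <= M.
Proof.
move=> cK; have := continuous_compact
  (continuous_subspaceT (mass_continuous (@measurableT _ _))) cK.
move/compact_bounded => -[M [_ bM]]; exists (M + 1) => P KP.
apply: le_trans (ler_norm _) _; apply: (bM (M + 1)); first by rewrite ltrDl.
by exists P.
Qed.

(** Take P_j with P_j(D_j) >= e and a cluster point Q of the sequence. As the D_j
    decrease, P_i(D_j) >= e for i >= j, so Q(D_j) >= e for every j, although the
    finite measure Q is continuous from above. *)
Lemma compact_uniformly_continuous K (D : nat -> set (borel Omega)) (e : R) :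
  compact K -> (forall j, measurable (D j)) ->
  (forall i j, (i <= j)%N -> D j `<=` D i) -> \bigcap_j D j = set0 -> 0 < e ->
  exists j, forall P, K P -> fine (P (D j)) < e.
Proof.
move=> cK mD decD D0 e0; apply/not_existsP => bad.
have /choice[p pP] : forall j, exists P, K P /\ e <= fine (P (D j)).
  move=> j; have /existsNP[P /not_implyP[KP /negP]] := bad j.
  by rewrite -leNgt => ?; exists P.
have [Q [_ clQ]] : exists Q, K Q /\ cluster ((p : nat -> tau) @ \oo) Q.
  have [|Q [KQ clQ]] := cK ((p : nat -> tau) @ \oo) _; last by exists Q.
  by exists 0%N => // j _ /=; have [] := pP j.
have QD j : e <= fine (Q (D j)).
  have cl := @mass_ge_closed _ (mD j) e.
  apply: cl; rewrite closureEcluster; apply: cvg_cluster clQ => U /= gU.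
  exists j => // i /= ji; apply: gU; have [_ ei] := pP i; apply: le_trans ei _.
  apply: fine_le; rewrite ?fin_num_measure//; apply: le_measure; rewrite ?inE//.
  exact: decD.
have : Q (D j) @[j --> \oo] --> Q (\bigcap_j D j).
  apply: nonincreasing_cvg_mu => //.
  - by rewrite ltey_eq fin_num_measure.
  - by rewrite D0.
  - by move=> i j ij; apply/subsetPset; exact: decD.
rewrite D0 measure0 => /fine_cvgP[_ /= c0].
move/cvgrPdist_lt/(_ e e0) : c0 => [N _ /(_ N (leqnn N))].
by rewrite sub0r normrN ger0_norm ?fine_ge0// ltNge QD.
Qed.

(** If no finite measure works, build P_0, P_1, ... in K and sets A_n with
    P_n(A_n) >= e while P_0 + ... + P_(n-1) gives A_n a mass below 2^(-n-1). By
    Borel-Cantelli the upper limit L of the A_n is null for every P_i, so the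
    tail unions of the A_n, deprived of L, decrease to the empty set and
    keep mass at least e for some member of K, against uniform continuity. *)
Lemma compact_uniformly_dominated K (e : R) : compact K -> 0 < e ->
  exists nu (dl : R), 0 < dl /\
    forall P A, K P -> measurable A -> fine (nu A) < dl -> fine (P A) < e.
Proof.
move=> cK e0; apply: contrapT => /forallNP bad.
have /choice[f fP] : forall x : fmeas R Omega * nat,
    exists y : fmeas R Omega * set (borel Omega),
    [/\ K y.1, measurable y.2, fine (x.1 y.2) < 2 ^- x.2.+1 & e <= fine (y.1 y.2)].
  move=> [nu n]; have /forallNP/(_ (2 ^- n.+1)) := bad nu.
  move=> /not_andP[|]; first by rewrite invr_gt0 exprn_gt0.
  move=> /existsNP[P /existsNP[A /not_implyP[KP /not_implyP[mA]]]].
  by move=> /not_implyP[nuA /negP]; rewrite -leNgt; exists (P, A).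
pose zero : fmeas R Omega := mzero.
(* nu n is the sum of the measures chosen before step n. *)
pose nu := fix nu n := if n is n'.+1 then fmeas_add (nu n') (f (nu n', n')).1 else zero.
pose p n := (f (nu n, n)).1.
pose A n := (f (nu n, n)).2.
have pK n : K (p n) by have [] := fP (nu n, n).
have mA n : measurable (A n) by have [] := fP (nu n, n).
have nuA n : fine (nu n (A n)) < 2 ^- n.+1 by have [] := fP (nu n, n).
have pA n : e <= fine (p n (A n)) by have [] := fP (nu n, n).
have p_le_nu i n X : (i < n)%N -> (p i X <= nu n X)%E.
  elim: n => // n IH; rewrite ltnS leq_eqVlt => /predU1P[->|/IH le] /=.
    by rewrite fmeas_addE leeDr.
  by rewrite fmeas_addE; apply: le_trans le _; rewrite leeDl.
pose L := lim_sup_set A.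
pose U j := \bigcup_(k >= j) A k.
have mU j : measurable (U j) by exact: bigcup_measurable.
have mL : measurable L by apply: bigcap_measurable => // k _; exact: mU.
have p0 i : p i L = 0%E.
  apply: lim_sup_set_cvg0 => //.
  (* For n <= i nothing is known about p i (A n) beyond the total mass of p i;
     the factor 2 ^+ i.+1 makes c / 2 ^ n.+1 at least that mass. *)
  pose c : R := 2 ^+ i.+1 * (fine (p i setT) + 1).
  have m0 : 0 <= fine (p i setT) by rewrite fine_ge0.
  have c0 : 0 <= c by rewrite mulr_ge0// addr_ge0.
  apply: le_lt_trans (ltry c); apply: le_trans (epsilon_trick0 xpredT c0).
  apply: lee_nneseries => // n _.
  apply: (@le_trans _ _ (fine (p i (A n)))%:E).
    by rewrite fineK ?fin_num_measure.
  rewrite lee_fin.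
  have [ni|lt_in] := leqP n i.
    apply: (@le_trans _ _ (fine (p i setT))).
      by apply: fine_le; rewrite ?fin_num_measure//; apply: le_measure; rewrite ?inE.
    rewrite ler_pdivlMr ?ltr0n ?expn_gt0// natrX mulrC.
    apply: ler_pM => //; last by rewrite lerDl.
    by rewrite ler_weXn2l// ler1n.
  apply: (@le_trans _ _ (fine (nu n (A n)))).
    by apply: fine_le; rewrite ?fin_num_measure//; exact: p_le_nu.
  apply: ltW; apply: lt_le_trans (nuA n) _.
  rewrite natrX -[leLHS]mul1r ler_pM2r ?invr_gt0 ?exprn_gt0//.
  rewrite -[leLHS]mulr1 ler_pM// ?lerDr//.
  by rewrite exprn_ege1// ler1n.
have [j small] : exists j, forall P, K P -> fine (P (U j `\` L)) < e.
  apply: compact_uniformly_continuous => //.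
  - by move=> j; exact: measurableD.
  - move=> i j ij x [[k /= jk Ak] Lx]; split=> //.
    by exists k => //=; exact: leq_trans jk.
  - rewrite -subset0 => x Dx; have [_ nL] := Dx 0%N I; apply: nL => k _.
    by have [] := Dx k I.
have := small (p j) (pK j); apply/negP; rewrite -leNgt.
apply: le_trans (pA j) _; apply: fine_le; rewrite ?fin_num_measure//.
  exact: measurableD.
have -> : p j (U j `\` L) = p j (U j).
  rewrite measureD//; first last.
    by rewrite ltey_eq fin_num_measure.
  rewrite [X in (_ - X)%E](_ : _ = 0%E) ?sube0//.
  by apply/eqP; rewrite eq_le measure_ge0 andbT -(p0 j) le_measure ?inE//; exact: measurableI.
by apply: le_measure; rewrite ?inE//; move=> x Ax; exists j => /=.
Qed.

(** H is the positive part in a Hahn decomposition of P - C nu, where nu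
    dominates K uniformly: there C nu(H) <= P(H) is bounded on K, so nu(H) is
    small once C is large, hence so is P(H). *)
Lemma compact_truncation K (e : R) : compact K -> 0 < e ->
  exists nu, forall P, K P -> exists H : set (borel Omega),
    [/\ measurable H, fine (P H) <= e
      & forall A, measurable A -> A `<=` ~` H -> (P A <= nu A)%E].
Proof.
move=> cK e0; have [nu [dl [dl0 ac]]] := compact_uniformly_dominated cK e0.
have [M0 bM0] := compact_mass_bounded cK; pose M := `|M0| + 1.
have M_gt0 : 0 < M by rewrite ltr_pwDr.
have bM P : K P -> fine (P setT) < M.
  move=> /bM0 h; apply: le_lt_trans h _.
  by rewrite (le_lt_trans (ler_norm M0))// ltrDl.
have C0 : 0 <= M / dl by rewrite divr_ge0// ltW.
pose nuC := fmeas_scale (NngNum C0) nu.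
exists nuC => P KP.
pose ch : {charge set _ -> \bar R} :=
  cadd (charge_of_finite_measure P) (copp (charge_of_finite_measure nuC)).
have [H [N [[mH posH] [mN negN] HN HN0]]] := Hahn_decomposition ch.
have le_of_sub X (P1 P2 : fmeas R Omega) : measurable X ->
    (P1 X - P2 X <= 0)%E -> (P1 X <= P2 X)%E.
  by move=> mX; rewrite sube_le0.
exists H; split=> //.
  apply: ltW; apply: ac => //.
  have : (nuC H <= P H)%E.
    have : (0 <= P H - nuC H)%E by exact: (posH H mH (@subset_refl _ H)).
    by rewrite sube_ge0// fin_num_measure// orbT.
  rewrite /nuC fmeas_scaleE/= -[nu H]fineK ?fin_num_measure//.
  rewrite -[P H]fineK ?fin_num_measure// -EFinM lee_fin => h.
  have : M / dl * fine (nu H) < M.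
    apply: le_lt_trans h _; apply: le_lt_trans (bM _ KP).
    by apply: fine_le; rewrite ?fin_num_measure//; apply: le_measure; rewrite ?inE.
  by rewrite mulrAC ltr_pdivrMr// ltr_pM2l.
move=> A mA AH; apply: le_of_sub => //; apply: (negN A mA) => x Ax.
have : (H `|` N) x by rewrite HN.
by case=> // /(AH _ Ax).
Qed.

End tau_compactness.

(** * Approximation by an algebra of sets *)

Section approximation_by_algebra.
Context d (T : measurableType d) (R : realType).
Variable mu : {finite_measure set T -> \bar R}.
Implicit Types E F V : set T.

Lemma le_measure_setYA E V F : measurable E -> measurable V -> measurable F ->
  (mu (E `+` F) <= mu (E `+` V) + mu (V `+` F))%E.
Proof.
move=> mE mV mF.
have m1 : measurable (E `+` V) by apply: measurableU; exact: measurableD.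
have m2 : measurable (V `+` F) by apply: measurableU; exact: measurableD.
apply: (@le_trans _ _ (mu ((E `+` V) `|` (V `+` F)))); last exact: measureU2.
apply: le_measure; rewrite ?inE.
- by apply: measurableU; exact: measurableD.
- exact: measurableU.
- move=> x [[Ex nFx]|[Fx nEx]].
    by have [Vx|nVx] := pselect (V x); [right; left|left; left].
  by have [Vx|nVx] := pselect (V x); [left; right|right; right].
Qed.

Lemma le_measure_setY E F : measurable E -> measurable F ->
  (mu E <= mu F + mu (E `+` F))%E.
Proof.
move=> mE mF.
have mY : measurable (E `+` F) by apply: measurableU; exact: measurableD.
apply: le_trans (measureU2 mu mF mY); apply: le_measure; rewrite ?inE//.
  exact: measurableU.
by move=> x Ex; have [Fx|nFx] := pselect (F x); [left|right; left].
Qed.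

Definition approximable (G : set (set T)) : set (set T) := [set E |
  measurable E /\ forall e : R, 0 < e ->
    exists2 F, G F & (mu (E `+` F) < e%:E)%E].

Variable G : set (set T).
Hypothesis G_measurable : forall F, G F -> measurable F.
Hypothesis GC : forall F, G F -> G (~` F).
Hypothesis GU : forall F F', G F -> G F' -> G (F `|` F').
Hypothesis G0 : G set0.

Lemma approximable_in F : G F -> approximable G F.
Proof.
move=> GF; split; first exact: G_measurable.
by move=> e e0; exists F => //; rewrite setYK measure0 lte_fin.
Qed.

Lemma approximableU E E' : approximable G E -> approximable G E' ->
  approximable G (E `|` E').
Proof.
move=> [mE aE] [mE' aE']; split; first exact: measurableU.
move=> e e0; have e20 : 0 < e / 2 by rewrite divr_gt0.
have [F GF EF] := aE _ e20; have [F' GF' EF'] := aE' _ e20.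
have mF := G_measurable GF; have mF' := G_measurable GF'.
have m1 : measurable (E `+` F) by apply: measurableU; exact: measurableD.
have m2 : measurable (E' `+` F') by apply: measurableU; exact: measurableD.
exists (F `|` F'); first exact: GU.
rewrite (splitr e) EFinD; apply: le_lt_trans (lteD EF EF').
apply: le_trans (measureU2 mu m1 m2); apply: le_measure; rewrite ?inE.
- by apply: measurableU; apply: measurableD; exact: measurableU.
- exact: measurableU.
- move=> x [[[Ex|Ex] nF]|[[Fx|Fx] nE]].
  + by left; left; split=> // ?; apply: nF; left.
  + by right; left; split=> // ?; apply: nF; right.
  + by left; right; split=> // ?; apply: nE; left.
  + by right; right; split=> // ?; apply: nE; right.
Qed.

(** A countable union is within e / 2 of a finite partial union, and the latter
    is approximated set by set. *)
Lemma approximable_sigma_algebra : sigma_algebra setT (approximable G).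
Proof.
split.
- exact: approximable_in.
- move=> E [mE aE]; rewrite setTD; split; first exact: measurableC.
  move=> e e0; have [F GF EF] := aE _ e0; exists (~` F); first exact: GC.
  rewrite (_ : _ `+` _ = E `+` F)//; apply/seteqP; split=> x.
    by move=> [[nE /contrapT Fx]|[nF /contrapT Ex]]; [right|left].
  by move=> [[Ex nFx]|[Fx nEx]]; [right|left]; split=> // h; exact: h.
- move=> E aE.
  have mE k : measurable (E k) by have [] := aE k.
  have mU : measurable (\bigcup_k E k) by exact: bigcupT_measurable.
  split=> // e e0; have e20 : 0 < e / 2 by rewrite divr_gt0.
  pose V N := \bigcup_(k in [set k | (k < N)%N]) E k.
  have aV N : approximable G (V N).
    elim: N => [|N IH]; first by rewrite /V bigcup0//; exact: approximable_in.
    rewrite (_ : V N.+1 = V N `|` E N); first exact: approximableU.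
    apply/seteqP; split=> x.
      move=> [k /=]; rewrite ltnS leq_eqVlt => /predU1P[->|kN] Ek; first by right.
      by left; exists k.
    by move=> [[k /= kN Ek]|EN]; [exists k => //=; exact: ltnW|exists N => /=].
  have mV N : measurable (V N) by have [] := aV N.
  have cvgV : mu (V N) @[N --> \oo] --> mu (\bigcup_k E k).
    rewrite (_ : \bigcup_k E k = \bigcup_N V N).
      apply: nondecreasing_cvg_mu => //; first exact: bigcupT_measurable.
      move=> i j ij; apply/subsetPset => x [k /= ki Ek]; exists k => //=.
      exact: leq_trans ki ij.
    apply/seteqP; split=> x [k _].
      by move=> Ek; exists k.+1 => //; exists k => /=.
    by move=> [i _ Ei]; exists i.
  have VU N : V N `<=` \bigcup_k E k by move=> x [k _ Ek]; exists k.
  have [N HN] : exists N, (mu (\bigcup_k E k `\` V N) < (e / 2)%:E)%E.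
    have fU : mu (\bigcup_k E k) \is a fin_num by exact: fin_num_measure.
    rewrite -[mu (\bigcup_k E k)]fineK// in cvgV.
    have /fine_cvgP[_ /cvgrPdist_lt/(_ _ e20)[N _ /(_ N (leqnn N))/= HN]] := cvgV.
    exists N; rewrite measureD//; last by rewrite ltey_eq fU.
    rewrite (setIidr (VU N)).
    rewrite (_ : (_ - _)%E = (fine (mu (\bigcup_k E k)) - fine (mu (V N)))%:E).
      by rewrite lte_fin; apply: le_lt_trans HN; exact: ler_norm.
    by rewrite EFinB !fineK// fin_num_measure.
  have [_ /(_ _ e20)[F GF VF]] := aV N; exists F => //.
  apply: le_lt_trans (le_measure_setYA mU (mV N) (G_measurable GF)) _.
  rewrite (splitr e) EFinD; apply: lteD => //.
  by rewrite setY_def (_ : V N `\` _ = set0) ?setU0// setD_eq0; exact: VU.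
Qed.

End approximation_by_algebra.

(** * Tables of counts *)

Section finite_disjoint_unions.
Context d (T : measurableType d) (R : realType) (mu : {measure set T -> \bar R}).

Lemma measure_disjoint_finType (I : finType) (F : I -> set T) (J : {set I}) :
  (forall i, measurable (F i)) -> (forall i j x, F i x -> F j x -> i = j) ->
  measurable (\bigcup_(i in [set` J]) F i) /\
  mu (\bigcup_(i in [set` J]) F i) = (\sum_(i in J) mu (F i))%E.
Proof.
move=> mF dF.
have -> : \bigcup_(i in [set` J]) F i = [set x | exists2 i, i \in enum J & F i x].
  by apply/seteqP; split=> x [i /= iJ Fi]; exists i; rewrite ?mem_enum// in iJ *.
rewrite -big_enum/=; elim: (enum J) (enum_uniq J) => [_|i s IH /= /andP[si us]].
  rewrite big_nil (_ : [set _ | _] = set0) ?measure0//.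
  by rewrite -subset0 => x [].
have [mS muS] := IH us.
rewrite (_ : [set _ | _] = F i `|` [set x | exists2 j, j \in s & F j x]).
  split; first exact: measurableU.
  rewrite big_cons -muS; apply: measureU => //.
  rewrite -subset0 => x [Fi [j js Fj]].
  by move: si; rewrite (dF _ _ _ Fi Fj) js.
apply/seteqP; split=> x.
  by move=> [j]; rewrite inE => /predU1P[->|js] Fj; [left|right; exists j].
by move=> [Fi|[j js Fj]]; [exists i|exists j]; rewrite // inE ?eqxx ?js ?orbT.
Qed.

End finite_disjoint_unions.

Section count_tables.
Context (R : realType) (Omega : ptopologicalType).
Local Notation tuples n := (n.-tuple (point_measure R Omega)).

Lemma measurable_tuple_count n (i : 'I_n) (B : set (borel Omega)) (Y : set (\bar R)) :
  measurable B -> measurable Y ->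
  measurable [set x : tuples n | Y (tnth x i B)].
Proof.
move=> mB mY; have := measurable_tnth i measurableT (measurable_count mB mY).
by rewrite setTI.
Qed.

Definition measurable_label (I : finType) (b : borel Omega -> I) :=
  forall j, measurable (b @^-1` [set j]).

Definition table n (I : finType) (b : borel Omega -> I) (x : tuples n) :
    'I_n -> I -> \bar R :=
  fun i j => tnth x i (b @^-1` [set j]).

(** Partitions are encoded by labels, so that disjointness and covering hold by
    construction and the common refinement of two partitions is the pair of
    labels. Counts may be infinite here; only the laws exclude it. *)
Definition table_event n : set (set (tuples n)) := [set E | measurable E /\
  exists (I : finType) (b : borel Omega -> I) (T : set ('I_n -> I -> \bar R)),
    measurable_label b /\ E = table b @^-1` T].

Lemma mass_label_sum (kappa : {measure set (borel Omega) -> \bar R}) (I : finType)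
    (b : borel Omega -> I) (B : set (borel Omega)) :
  measurable_label b -> measurable B ->
  kappa B = (\sum_j kappa (B `&` b @^-1` [set j]))%E.
Proof.
move=> mb mB.
have [_] := @measure_disjoint_finType _ _ _ kappa I
  (fun j => B `&` b @^-1` [set j]) [set: I]%SET
  (fun j => measurableI _ _ mB (mb j))
  (fun i j x => fun '(conj _ bi) '(conj _ bj) => etrans (esym bi) bj).
rewrite (_ : \bigcup_(i in _) _ = B).
  by move=> ->; apply: eq_bigl => i; rewrite inE.
apply/seteqP; split=> x; first by move=> [i _ []].
by move=> Bx; exists (b x); rewrite /= ?inE.
Qed.

Lemma table_eventC n (E : set (tuples n)) : table_event E -> table_event (~` E).
Proof.
move=> [mE [I [b [T [mb ET]]]]]; split; first exact: measurableC.
by exists I, b, (~` T); split => //; rewrite ET.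
Qed.

Lemma table_event0 n : table_event (set0 : set (tuples n)).
Proof.
split=> //; exists unit, (fun=> tt), set0; split; last by rewrite preimage_set0.
move=> []; rewrite (_ : _ @^-1` _ = setT)//.
by apply/seteqP; split.
Qed.

(** Each of the two tables is obtained from the table of the common refinement
    by summing over the other label. *)
Lemma table_eventU n (E E' : set (tuples n)) :
  table_event E -> table_event E' -> table_event (E `|` E').
Proof.
move=> [mE [I [b [T [mb ET]]]]] [mE' [I' [b' [T' [mb' ET']]]]].
split; first exact: measurableU.
pose bb x := (b x, b' x).
exists (I * I')%type, bb, [set t |
  T (fun i j => \sum_j' t i (j, j'))%E \/ T' (fun i j' => \sum_j t i (j, j'))%E].
have bbE j j' : bb @^-1` [set (j, j')] = b @^-1` [set j] `&` b' @^-1` [set j'].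
  by apply/seteqP; split=> x; rewrite /bb/=; case=> -> ->.
split; first by move=> [j j']; rewrite bbE; exact: measurableI.
rewrite ET ET'; apply/seteqP.
have tE x : table b x = (fun i j => \sum_j' table bb x i (j, j'))%E.
  apply/funext => i; apply/funext => j.
  rewrite /table (mass_label_sum _ mb' (mb j)).
  by apply: eq_bigr => j' _; rewrite bbE.
have tE' x : table b' x = (fun i j' => \sum_j table bb x i (j, j'))%E.
  apply/funext => i; apply/funext => j'.
  rewrite /table (mass_label_sum _ mb (mb' j')).
  by apply: eq_bigr => j _; rewrite bbE setIC.
by split=> x; rewrite /= tE tE'.
Qed.

Lemma table_event_count n (i : 'I_n) (B : set (borel Omega)) (Y : set (\bar R)) :
  measurable B -> measurable Y ->
  table_event [set x : tuples n | Y (tnth x i B)].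
Proof.
move=> mB mY; split; first exact: measurable_tuple_count.
have bT : (fun x : borel Omega => x \in B) @^-1` [set true] = B.
  by apply/seteqP; split=> x /=; [exact: set_mem|exact: mem_set].
exists bool, (fun x => x \in B), [set t | Y (t i true)]; split.
  move=> [|]; first by rewrite bT.
  rewrite (_ : _ @^-1` _ = ~` B); first exact: measurableC.
  apply/seteqP; split=> x /=; first by move=> + Bx; rewrite (mem_set Bx).
  by move=> nB; apply/negbTE; rewrite notin_setE.
by apply/seteqP; split=> x; rewrite /= /table bT.
Qed.

(** The events determined by a table form an algebra, and it generates the
    sigma-algebra of the samples. *)
Lemma measurable_approximable n (mu : {finite_measure set (tuples n) -> \bar R})
    (E : set (tuples n)) : measurable E -> approximable mu (@table_event n) E.
Proof.
have sA := @approximable_sigma_algebra _ _ _ mu (@table_event n)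
  (fun F => @proj1 _ _) (@table_eventC n) (@table_eventU n) (table_event0 n).
have gen i (C : set (point_measure R Omega)) : measurable C ->
    approximable mu (@table_event n) ((fun x : tuples n => tnth x i) @^-1` C).
  pose D := [set C : set (point_measure R Omega) |
    approximable mu (@table_event n) ((fun x : tuples n => tnth x i) @^-1` C)].
  suff : <<s @count_events R Omega >> `<=` D by exact.
  apply: smallest_sub.
    have [s0 sC sU] := sA; split.
    - by rewrite /D/= preimage_set0.
    - by move=> A DA; exact: (sC _ DA).
    - by move=> A DA; rewrite /D/= preimage_bigcup; exact: sU.
  move=> _ [B mB [Y mY <-]]; rewrite setTI.
  apply: approximable_in; first by move=> F [].
  exact: table_event_count.
move=> mE; have : g_sigma_preimage (fun (i : 'I_n) (x : tuples n) => tnth x i) E by [].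
apply: smallest_sub => // A; rewrite -bigcup_seq => -[i _ [C mC <-]].
by rewrite setTI; exact: gen.
Qed.

Definition atom n (I : finType) (b : borel Omega -> I) N
    (k : {ffun 'I_n * I -> 'I_N}) : set (tuples n) :=
  [set x : tuples n | forall i j, tnth x i (b @^-1` [set j]) = (k (i, j))%:R%:E].

Lemma measurable_atom n (I : finType) (b : borel Omega -> I) N
    (k : {ffun 'I_n * I -> 'I_N}) : measurable_label b -> measurable (atom b k).
Proof.
move=> mb; rewrite (_ : atom b k = \bigcap_(p in [set: 'I_n * I])
    [set x : tuples n | [set (k p)%:R%:E] (tnth x p.1 (b @^-1` [set p.2]))]).
  apply: fin_bigcap_measurable => // p _.
  exact: (measurable_tuple_count _ (mb p.2) (emeasurable_set1 _)).
apply/seteqP; split=> x; first by move=> h [i j] _; exact: h.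
by move=> h i j; exact: (h (i, j) Logic.I).
Qed.

Lemma atom_inj n (I : finType) (b : borel Omega -> I) N
    (k k' : {ffun 'I_n * I -> 'I_N}) x : atom b k x -> atom b k' x -> k = k'.
Proof.
move=> kx kx'; apply/ffunP => -[i j]; apply/val_inj/eqP.
have := kx i j; rewrite kx' => -[/eqP].
by rewrite eqr_nat eq_sym.
Qed.

Definition atoms n (I : finType) (b : borel Omega -> I) N
    (J : {set {ffun 'I_n * I -> 'I_N}}) : set (tuples n) :=
  \bigcup_(k in [set` J]) atom b k.

(** An event determined by a table depends on infinitely many values of the
    counts. Those with some count at least N have small measure for large N,
    because all counts are almost surely finite. *)
Lemma approximation_by_atoms n (mu : {finite_measure set (tuples n) -> \bar R})
    (E : set (tuples n)) (e : R) :
  (forall i, mu [set x : tuples n | tnth x i setT = +oo%E] = 0%E) ->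
  measurable E -> 0 < e ->
  exists (I : finType) (b : borel Omega -> I) N
      (J : {set {ffun 'I_n * I -> 'I_N}}),
    measurable_label b /\ (mu (E `+` atoms b J) < e%:E)%E.
Proof.
move=> mu_fin mE e0; have e20 : 0 < e / 2 by rewrite divr_gt0.
have [_ /(_ _ e20)[F [mF [I [b [T [mb FT]]]]] EF]] := measurable_approximable mu mE.
pose big N := \bigcup_(p in [set: 'I_n * I])
  [set x : tuples n | (N%:R%:E <= tnth x p.1 (b @^-1` [set p.2]))%E].
have mbig N : measurable (big N).
  apply: fin_bigcup_measurable => // p _.
  have := @measurable_tuple_count n p.1 _ [set y | (N%:R%:E <= y)%E] (mb p.2).
  by apply; rewrite -set_itvcy; exact: emeasurable_itv.
have big0 : mu (\bigcap_N big N) = 0%E.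
  pose inf i := [set x : tuples n | tnth x i setT = +oo%E].
  have minf i : measurable (inf i).
    exact: (measurable_tuple_count i measurableT (emeasurable_set1 _)).
  pose infs := \big[setU/set0]_(i < n) inf i.
  have [minfs infs0] : measurable infs /\ mu infs = 0%E.
    rewrite /infs; elim/big_rec : _ => [|i X _ [mX X0]]; first by rewrite measure0.
    split; first exact: measurableU.
    apply/eqP; rewrite eq_le measure_ge0 andbT.
    have iX0 : (mu (inf i) + mu X = 0)%E by rewrite X0 adde0; exact: mu_fin.
    apply: le_trans (measureU2 mu (minf i) mX) _.
    by rewrite -[leRHS]iX0.
  have sub : \bigcap_N big N `<=` infs.
    move=> x bx; apply: contrapT => ninf.
    have fin i : exists c : nat, tnth x i setT = c%:R%:E.
      case: (pm_valP (tnth x i) measurableT) => // xi.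
      by exfalso; apply: ninf; rewrite /infs -bigcup_seq; exists i; rewrite //= mem_index_enum.
    have /choice[c cE] := fin.
    have [[i j] _ /=] := bx (\max_i c i).+1 Logic.I.
    apply/negP; rewrite -ltNge.
    apply: (@le_lt_trans _ _ (tnth x i setT)).
      by apply: le_measure; rewrite ?inE//; exact: mb.
    by rewrite cE lte_fin ltr_nat ltnS; exact: leq_bigmax.
  apply/eqP; rewrite eq_le measure_ge0 andbT -infs0.
  by apply: le_measure; rewrite ?inE//; exact: bigcapT_measurable.
have cvgb : mu (big N) @[N --> \oo] --> mu (\bigcap_N big N).
  apply: nonincreasing_cvg_mu => //; [|exact: bigcapT_measurable|].
    by rewrite ltey_eq fin_num_measure.
  move=> N N' NN'; apply/subsetPset => x [p _ /= h]; exists p => //=.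
  by apply: le_trans h; rewrite lee_fin ler_nat.
have [N HN] : exists N, (mu (big N) < (e / 2)%:E)%E.
  rewrite big0 in cvgb.
  have /fine_cvgP[_ /cvgrPdist_lt/(_ _ e20)[N _ /(_ N (leqnn N))/= HN]] := cvgb.
  exists N; rewrite sub0r normrN ger0_norm ?fine_ge0// in HN.
  by rewrite -[mu (big N)]fineK ?fin_num_measure// lte_fin.
pose J := [set k : {ffun 'I_n * I -> 'I_N} |
  `[< T (fun i j => (k (i, j))%:R%:E) >]]%SET.
exists I, b, N, J; split=> //.
(* Outside big N all counts are natural numbers below N. *)
have FJ : F `\` big N = atoms b J.
  apply/seteqP; split=> x.
    move=> [Fx nbig].
    have fin (p : 'I_n * I) : exists c : 'I_N,
        tnth x p.1 (b @^-1` [set p.2]) = c%:R%:E.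
      have lt : (tnth x p.1 (b @^-1` [set p.2]) < N%:R%:E)%E.
        by rewrite ltNge; apply/negP => h; apply: nbig; exists p.
      case: (pm_valP (tnth x p.1) (mb p.2)) => [xi|[c xi]].
        by rewrite xi in lt.
      have cN : (c < N)%N by move: lt; rewrite xi lte_fin ltr_nat.
      by exists (Ordinal cN).
    have /choice[c cE] := fin.
    exists [ffun p => c p]; last by move=> i j; rewrite ffunE (cE (i, j)).
    rewrite /= inE; apply/asboolP; move: Fx; rewrite FT /=.
    congr T; apply/funext => i; apply/funext => j; rewrite ffunE.
    exact: (cE (i, j)).
  move=> [k /=]; rewrite inE => /asboolP Tk kx; split.
    rewrite FT /=; move: Tk; congr T; apply/funext => i; apply/funext => j.
    by rewrite /table kx.
  move=> [[i j] _ /=]; rewrite kx lee_fin ler_nat leqNgt => /negP; apply.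
  exact: ltn_ord.
rewrite -FJ.
apply: le_lt_trans (le_measure_setYA mu mE mF _) _; first exact: measurableD.
rewrite (splitr e) EFinD; apply: lteD => //.
apply: le_lt_trans HN; apply: le_measure; rewrite ?inE//.
  by apply: measurableU; apply: measurableD => //; exact: measurableD.
move=> x [[Fx nFb]|[[Fx _] /(_ Fx)//]].
by apply: contrapT => nb; apply: nFb.
Qed.

End count_tables.

(** * Laws of Poisson samples *)

Section poisson_laws.
Context (R : realType) (Omega : ptopologicalType).
Variable S : forall (P : fmeas R Omega) (n : nat), poisson_sample P n.
Implicit Types P Q nu : fmeas R Omega.
Local Notation tuples n := (n.-tuple (point_measure R Omega)).

(** The Poisson probability of k at rate p, which is 1 for p = 0 and k = 0
    and 0 for p = 0 and k > 0. *)
Definition poisson_weight (p : R) (k : nat) : R := expR (- p) * p ^+ k / k`!%:R.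

Lemma poisson_weight_ge0 p k : 0 <= p -> 0 <= poisson_weight p k.
Proof. by move=> p0; rewrite divr_ge0// mulr_ge0 ?expR_ge0// exprn_ge0. Qed.

HB.instance Definition _ P n :=
  isMeasurableFun.Build _ _ _ _ (@sample_tuple R Omega S P n)
    (@measurable_sample_tuple R Omega S P n).

Definition law P n : probability (tuples n) R :=
  distribution (ps_prob (S P n)) (@sample_tuple R Omega S P n).

Lemma lawE P n E :
  law P n E = ps_prob (S P n) (@sample_tuple R Omega S P n @^-1` E).
Proof. by []. Qed.

(** Real-valued, so that linear arithmetic applies. *)
Definition lawr P n (E : set (tuples n)) : R := fine (law P n E).

Lemma law_fineK P n E : measurable E -> law P n E = (lawr P E)%:E.
Proof. by move=> mE; rewrite /lawr fineK// fin_num_measure. Qed.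

Lemma sample_mean_indic P n (E : set (tuples n)) : measurable E ->
  sample_mean (S P n) \1_E = lawr P E.
Proof.
move=> mE; rewrite sample_meanE.
rewrite (_ : (fun w => _) = \1_(@sample_tuple R Omega S P n @^-1` E))//.
rewrite integral_indic_fine//.
by rewrite -[X in measurable X]setTI; exact: measurable_sample_tuple.
Qed.

(** The Poisson probabilities of the finite counts already sum to one. *)
Lemma point_count_fin P d (X : measurableType d) (Pr : probability X R)
    (kappa : X -> point_measure R Omega) (B : set (borel Omega)) :
  poisson_process Pr P kappa -> measurable B ->
  Pr [set w | kappa w B = +oo%E] = 0%E.
Proof.
move=> [mk law_k _] mB; set p := fine (P B).
have mcount (Y : set (\bar R)) : measurable Y ->
    measurable [set w | Y (kappa w B)].
  by move=> mY; rewrite -[X in measurable X]setTI; exact: (mk _ _ (measurable_count mB mY)).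
pose F m (k : 'I_m) := [set w | kappa w B = k%:R%:E].
have mF m k : measurable (@F m k) by exact: (mcount _ (emeasurable_set1 _)).
have mI : measurable [set w | kappa w B = +oo%E] by exact: (mcount _ (emeasurable_set1 _)).
apply/eqP; rewrite eq_le measure_ge0 andbT.
rewrite -[Pr _]fineK ?fin_num_measure// lee_fin.
have partial m : fine (Pr [set w | kappa w B = +oo%E]) <=
    1 - expR (- p) * series (exp_coeff p) m.
  have dF (i j : 'I_m) x : F m i x -> F m j x -> i = j.
    by rewrite /F/= => -> [/eqP]; rewrite eqr_nat => /eqP/val_inj.
  have [mU muU] := measure_disjoint_finType Pr [set: 'I_m]%SET (mF m) dF.
  set U := \bigcup_(i in _) _ in mU muU.
  have UE : Pr U = (expR (- p) * series (exp_coeff p) m)%:E.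
    rewrite muU /series /= big_mkord mulr_sumr -sumEFin.
    by apply: eq_big => [i|i _]; rewrite ?inE// law_k// /exp_coeff mulrA.
  rewrite lerBrDr -lee_fin EFinD fineK ?fin_num_measure// -UE -measureU//.
    by apply: probability_le1; exact: measurableU.
  rewrite -subset0 => w [wI [k _ wk]].
  by move: wk; rewrite /F /= wI.
have : (fun m => 1 - expR (- p) * series (exp_coeff p) m) @ \oo --> (0 : R).
  rewrite -(subrr 1) -{3}(expRxMexpNx_1 p) mulrC.
  apply: cvgB; first exact: cvg_cst.
  by apply: cvgMr; exact: is_cvg_series_exp_coeff.
move=> c0; rewrite -(cvg_lim _ c0)//; apply: limr_ge.
  by apply/cvg_ex; exists 0.
by exists 0%N => // m _; exact: partial.
Qed.

Lemma law_infinite P n (i : 'I_n) :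
  law P n [set x : tuples n | tnth x i setT = +oo%E] = 0%E.
Proof.
rewrite lawE (_ : _ @^-1` _ = [set w | ps_kappa (p := S P n) i w setT = +oo%E]).
  exact: (point_count_fin (ps_poisson (S P n) i)).
by apply/seteqP; split=> w; rewrite /= tnth_mktuple.
Qed.

(** Independence is used twice: between the samples, and between the counts of
    one sample on the disjoint cells of the partition. *)
Lemma lawr_atom P n (I : finType) (b : borel Omega -> I) N
    (k : {ffun 'I_n * I -> 'I_N}) : measurable_label b ->
  lawr P (atom b k) =
  \prod_i \prod_j poisson_weight (fine (P (b @^-1` [set j]))) (k (i, j)).
Proof.
move=> mb.
have mk i : measurable_fun setT (ps_kappa (p := S P n) i).
  by have [] := ps_poisson (S P n) i.
pose A i := [set kappa : point_measure R Omega |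
  forall j, kappa (b @^-1` [set j]) = (k (i, j))%:R%:E].
have mA i : measurable (A i).
  rewrite (_ : A i = \bigcap_(j in [set: I]) [set kappa : point_measure R Omega |
      [set (k (i, j))%:R%:E] (kappa (b @^-1` [set j]))]).
    apply: fin_bigcap_measurable => // j _.
    exact: (measurable_count (mb j) (emeasurable_set1 _)).
  by apply/seteqP; split=> x h j => [_|]; apply: h.
have : lawr P (atom b k) = \prod_(i < n) fine (ps_prob (S P n) (ps_kappa i @^-1` A i)).
  rewrite -(@ps_indep _ _ P n (S P n) A mA); congr (fine (ps_prob _ _)).
  apply/seteqP; split=> w h i; first by move=> _ j; have := h i j; rewrite tnth_mktuple.
  by move=> j; rewrite tnth_mktuple; exact: h.
move=> ->; apply: eq_bigr => i _.
have [_ law_k indep_k] := ps_poisson (S P n) i.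
pose B (j : 'I_#|I|) := b @^-1` [set enum_val j].
have mB j : measurable (B j) by exact: mb.
have tB : trivIset setT B.
  move=> j j' _ _ [x [/= bx bx']].
  by apply: enum_val_inj; rewrite -bx -bx'.
pose C (j : 'I_#|I|) : set (\bar R) := [set (k (i, enum_val j))%:R%:E].
have mC j : measurable (C j) by exact: emeasurable_set1.
have := indep_k _ B mB tB C mC.
rewrite (_ : \bigcap_j _ = ps_kappa i @^-1` A i); last first.
  apply/seteqP; split=> w h j; last by move=> _; exact: h.
  by have := h (enum_rank j) Logic.I; rewrite /B /C /= enum_rankK.
move=> ->.
rewrite (reindex (@enum_val _ I)) /=; last first.
  exact: onW_bij (enum_val_bij I).
by apply: eq_bigr => j _; rewrite law_k.
Qed.

Lemma lawr_atoms P n (I : finType) (b : borel Omega -> I) N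
    (J : {set {ffun 'I_n * I -> 'I_N}}) : measurable_label b ->
  lawr P (atoms b J) = \sum_(k in J)
    \prod_i \prod_j poisson_weight (fine (P (b @^-1` [set j]))) (k (i, j)).
Proof.
move=> mb; have [mJ muJ] := measure_disjoint_finType (law P n) J
  (fun k => measurable_atom k mb) (fun k k' x => @atom_inj _ _ _ _ _ _ k k' x).
rewrite /lawr muJ (eq_bigr (fun k => (lawr P (atom b k))%:E)); last first.
  by move=> k _; apply: law_fineK; exact: measurable_atom.
by rewrite sumEFin /=; apply: eq_bigr => k _; exact: lawr_atom.
Qed.

Lemma lawr_atoms_continuous n (I : finType) (b : borel Omega -> I) N
    (J : {set {ffun 'I_n * I -> 'I_N}}) : measurable_label b ->
  continuous (fun P : tau_space (@borel_indicators R Omega) => lawr P (atoms b J)).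
Proof.
move=> mb; under eq_fun do rewrite lawr_atoms//.
apply: continuous_big => [|k _]; first exact: add_continuous.
apply: continuous_big => [|i _]; first exact: mul_continuous.
apply: continuous_big => [|j _]; first exact: mul_continuous.
have wc (m : nat) : continuous (fun p : R => poisson_weight p m).
  move=> p; rewrite /poisson_weight; apply: cvgMl; apply: cvgM.
    apply: (@continuous_comp _ _ _ (fun x : R => - x) expR).
      exact: opp_continuous.
    exact: continuous_expR.
  exact: exprn_continuous.
move=> P; apply: (@continuous_comp _ _ _
  (fun Q : tau_space _ => fine (Q (b @^-1` [set j]))) (poisson_weight ^~ _)).
  exact: mass_continuous.
exact: wc.
Qed.

Lemma lawr_le_approx P n E F : measurable E -> measurable F ->
  lawr P E <= lawr P F + lawr (n := n) P (E `+` F).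
Proof.
move=> mE mF; have mY : measurable (E `+` F) by apply: measurableU; exact: measurableD.
rewrite -lee_fin EFinD -!law_fineK//; exact: le_measure_setY.
Qed.

(** In the Poisson probability of a table, the powers of the masses increase
    with the measure, and the exponential factors over all cells multiply to
    exp(-P(Omega)) for each sample. *)
Lemma lawr_atoms_le P nu n (I : finType) (b : borel Omega -> I) N
    (J : {set {ffun 'I_n * I -> 'I_N}}) : measurable_label b ->
  (forall A, measurable A -> (P A <= nu A)%E) ->
  lawr P (atoms b J) <=
  expR (n%:R * (fine (nu setT) - fine (P setT))) * lawr nu (atoms b J).
Proof.
move=> mb Pnu; rewrite !lawr_atoms// mulr_sumr; apply: ler_sum => k _.
have massE Q : fine (Q setT) = \sum_j fine (Q (b @^-1` [set j])).
  rewrite (mass_label_sum Q mb measurableT).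
  rewrite (eq_bigr (fun j => (fine (Q (b @^-1` [set j])))%:E)) ?sumEFin// => j _.
  by rewrite setTI fineK// fin_num_measure//; exact: mb.
have -> : expR (n%:R * (fine (nu setT) - fine (P setT))) =
    \prod_(i < n) \prod_j expR (fine (nu (b @^-1` [set j])) - fine (P (b @^-1` [set j]))).
  rewrite prodr_const card_ord expRM_natl; congr (_ ^+ _).
  by rewrite -expR_sum !massE sumrB.
rewrite -big_split /=; apply: ler_prod => i _.
rewrite prodr_ge0 => [|j _]; last by rewrite poisson_weight_ge0// fine_ge0.
rewrite /= -big_split /=; apply: ler_prod => j _.
rewrite poisson_weight_ge0 ?fine_ge0//=.
rewrite /poisson_weight !mulrA ler_pM2r ?invr_gt0 ?ltr0n ?fact_gt0//.
rewrite -expRD addrAC subrr sub0r ler_pM2l ?expR_gt0//.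
rewrite lerXn2r ?nnegrE ?fine_ge0//; apply: fine_le.
- by apply: fin_num_measure; exact: mb.
- by apply: fin_num_measure; exact: mb.
- by apply: Pnu; exact: mb.
Qed.

(** The bound holds for finite unions of atoms; approximate E by such a union in
    the sum of the two laws, so that one union is good for both. *)
Lemma lawr_le P nu n (E : set (tuples n)) : measurable E ->
  (forall A, measurable A -> (P A <= nu A)%E) ->
  lawr P E <= expR (n%:R * (fine (nu setT) - fine (P setT))) * lawr nu E.
Proof.
move=> mE Pnu; set c := expR _; have c0 : 0 < c by exact: expR_gt0.
apply/ler_addgt0Pr => e e0.
pose eta := e / (c + 1); have eta0 : 0 < eta by rewrite divr_gt0// addr_gt0.
(* One approximation has to serve both laws. *)
pose mu : {finite_measure set (tuples n) -> \bar R} := finite_add (law P n) (law nu n).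
have muE A : mu A = (law P n A + law nu n A)%E by exact: finite_addE.
have [|I [b [N [J [mb]]]]] := @approximation_by_atoms _ _ _ mu E eta _ mE eta0.
  by move=> i; rewrite muE !law_infinite adde0.
have mJ : measurable (atoms b J : set (tuples n)).
  by have [] := measure_disjoint_finType (law P n) J
  (fun k => measurable_atom k mb) (fun k k' x => @atom_inj _ _ _ _ _ _ k k' x).
have mY : measurable (E `+` atoms b J) by apply: measurableU; exact: measurableD.
have mY' : measurable (atoms b J `+` E) by rewrite setYC.
rewrite muE !law_fineK// -EFinD lte_fin => small.
have pos Q A : 0 <= lawr (n := n) Q A by rewrite fine_ge0.
have h1 := lawr_le_approx P mE mJ.
have h2 := lawr_le_approx nu mJ mE; rewrite setYC in h2.
have h3 := @lawr_atoms_le P nu n I b N J mb Pnu; rewrite -/c in h3.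
have pP := pos P (E `+` atoms b J); have pnu := pos nu (E `+` atoms b J).
have ce : e = c * eta + eta by rewrite /eta; field; rewrite gt_eqF// addr_gt0.
rewrite ce; nra.
Qed.

End poisson_laws.

(** * From tests to disjoint closures *)

Section tests_to_closures.
Context (R : realType) (Omega : ptopologicalType).
Variable S : forall (P : fmeas R Omega) (n : nat), poisson_sample P n.
Local Notation tuples n := (n.-tuple (point_measure R Omega)).
Local Notation tau := (tau_space (@borel_indicators R Omega)).

Lemma lawr_compl (P : fmeas R Omega) n (E : set (tuples n)) : measurable E ->
  lawr S P (~` E) = 1 - lawr S P E.
Proof. by move=> mE; rewrite /lawr probability_setC// law_fineK. Qed.

(** The restriction P' of P to the complement of H is at most P, so [lawr_le] bounds
    the probability of the complement of E under P' by exp(n P(H)) times that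
    under P; this is turned around with 1 - x <= exp(-x). *)
Lemma lawr_restr_le (P : fmeas R Omega) n (H : set (borel Omega))
    (mH : measurable H) (E : set (tuples n)) : measurable E ->
  lawr S P E <= n%:R * fine (P H) + lawr S (fmeas_restr P (measurableC mH)) E.
Proof.
move=> mE; set P' := fmeas_restr _ _; set dl := n%:R * _.
have P'P A : measurable A -> (P' A <= P A)%E.
  move=> mA; rewrite fmeas_restrE; apply: le_measure; rewrite ?inE//.
  by apply: measurableI => //; exact: measurableC.
have PH : fine (P setT) - fine (P' setT) = fine (P H).
  rewrite fmeas_restrE setTI -[in fine (P setT)](setUv H) measureU//.
  - by rewrite fineD ?fin_num_measure//; [ring|exact: measurableC].
  - exact: measurableC.
  - by rewrite setICr.
have := lawr_le S (measurableC mE) P'P; rewrite PH !lawr_compl// -/dl => le.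
have dl0 : 0 <= dl by rewrite mulr_ge0// fine_ge0.
have L'1 : 0 <= lawr S P' E by rewrite fine_ge0.
have L'2 : 0 <= 1 - lawr S P' E by rewrite -lawr_compl// fine_ge0.
have exd : 1 - dl <= expR (- dl) by exact: expR_ge1Dx.
have ex1 : expR (- dl) * (1 - lawr S P' E) <= 1 - lawr S P E.
  rewrite -(ler_pM2l (expR_gt0 dl)) mulrA expRxMexpNx_1 mul1r.
  exact: le.
nra.
Qed.

(** Truncate P outside a set of small mass, then compare the truncation with a
    measure that dominates all the truncations. *)
Lemma law_compact_dominated (K : set tau) n (e : R) : compact K -> 0 < e ->
  exists (nu : fmeas R Omega) (c : R), 0 < c /\
    forall P (E : set (tuples n)), K P -> measurable E ->
      lawr S P E <= e + c * lawr S nu E.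
Proof.
move=> cK e0; pose e' := e / n.+1%:R; have e'0 : 0 < e' by rewrite divr_gt0.
have [nu trunc] := compact_truncation cK e'0.
exists nu, (expR (n%:R * fine (nu setT))); split; first exact: expR_gt0.
move=> P E KP mE; have [H [mH PH dom]] := trunc P KP.
apply: le_trans (lawr_restr_le P mH mE) _; apply: lerD.
  apply: (@le_trans _ _ (n.+1%:R * e')).
    by apply: ler_pM; rewrite ?fine_ge0// ler_nat.
  by rewrite /e' mulrCA divff ?mulr1// pnatr_eq0.
have P'nu A : measurable A -> (fmeas_restr P (measurableC mH) A <= nu A)%E.
  move=> mA; rewrite fmeas_restrE.
  apply: (@le_trans _ _ (nu (A `&` ~` H))).
    by apply: dom => //; apply: measurableI => //; exact: measurableC.
  by apply: le_measure; rewrite ?inE//; apply: measurableI => //; exact: measurableC.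
apply: le_trans (lawr_le S mE P'nu) _.
rewrite ler_wpM2r ?fine_ge0// ler_expR ler_wpM2l//.
by rewrite lerBlDr lerDl fine_ge0.
Qed.

(** With n fixed so that both errors are small, E is the event that the
    test rejects with probability at least 1/2; by Markov's inequality it has
    small probability under A and large probability under B. Its probability
    varies by less than this gap near a common point of the closures. *)
Lemma separated_disjoint_closures (A B : set (fmeas R Omega)) :
  precompact (A : set tau) -> precompact (B : set tau) ->
  test_separated S A B ->
  closure (A : set tau) `&` closure (B : set tau) = set0.
Proof.
rewrite !precompactE => cA cB [K [tK KA KB]]; rewrite -subset0 => Q [QA QB].
have e0 : 0 < 16^-1 :> R by rewrite invr_gt0.
have [n [KAn KBn]] : exists n,
    (forall P, A P -> sample_mean (S P n) (K n) <= 16^-1) /\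
    (forall P, B P -> sample_mean (S P n) (fun x => 1 - K n x) <= 16^-1).
  by have [N _ /(_ N (leqnn N))] := filterI (KA _ e0) (KB _ e0); exists N.
have [mK K01] := tK n.
pose E := [set x | 2^-1 <= K n x].
have mE : measurable E.
  have := mK measurableT _ (measurable_itv `[2^-1, +oo[).
  by rewrite setTI; congr measurable; apply/seteqP; split=> x; rewrite /E/= in_itv/= andbT.
have bK := test_bmeas (tK n); have bK' := test_bmeas (test_compl (tK n)).
have EA P : A P -> lawr S P E <= 8^-1.
  move=> /KAn le; rewrite -sample_mean_indic//.
  apply: (@le_trans _ _ (sample_mean (S P n) (fun x => K n x + K n x))).
    apply: sample_mean_le; [exact: bmeas_indic|exact: bmeasD|].
    move=> x; rewrite indicE; case: (boolP (x \in E)); rewrite ?inE /E/=; last first.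
      by move=> _; have /andP[] := K01 x; lra.
    by lra.
  by rewrite sample_meanD//; lra.
have EB P : B P -> 1 - lawr S P E <= 8^-1.
  move=> /KBn le; rewrite -lawr_compl// -sample_mean_indic; last exact: measurableC.
  apply: (@le_trans _ _ (sample_mean (S P n) (fun x => (1 - K n x) + (1 - K n x)))).
    apply: sample_mean_le; [by apply: bmeas_indic; exact: measurableC|exact: bmeasD|].
    move=> x; rewrite indicE; case: (boolP (x \in ~` E)); rewrite ?inE /E/=.
      by move=> /negP; rewrite -ltNge; lra.
    by move=> _; have /andP[] := K01 x; lra.
  by rewrite sample_meanD//; lra.
have [nu [c [c0 dom]]] := law_compact_dominated n (compactU cA cB) e0.
(* The domination error and c times the approximation error are 1/16 each, so
   the probabilities of E and of its approximation differ by at most 1/8 on K. *)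
have eta0 : 0 < (16 * c)^-1 by rewrite invr_gt0 mulr_gt0.
have [|I [b [N [J [mb small]]]]] :=
    @approximation_by_atoms _ _ _ (law S nu n) E _ _ mE eta0.
  exact: law_infinite.
set F := atoms b J in small.
have mF : measurable F.
  by have [] := measure_disjoint_finType (law S nu n) J
    (fun k => measurable_atom k mb) (fun k k' x => @atom_inj _ _ _ _ _ _ k k' x).
have mY : measurable (E `+` F) by apply: measurableU; exact: measurableD.
have {}small : c * lawr S nu (E `+` F) <= 16^-1.
  have : (law S nu n (E `+` F) < ((16 * c)^-1)%:E)%E by exact: small.
  rewrite law_fineK// lte_fin => /ltW.
  by rewrite invfM -ler_pdivlMl// mulrC.
have close P : (closure (A : set tau) `|` closure (B : set tau)) P ->
    `|lawr S P E - lawr S P F| <= 8^-1.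
  move=> KP; have := dom P _ KP mY.
  have := lawr_le_approx S P mE mF; have := lawr_le_approx S P mF mE.
  by rewrite (setYC F) => *; rewrite ler_norml; apply/andP; split; lra.
have nearQ : nbhs (Q : tau) [set P : tau | `|lawr S Q F - lawr S P F| < 16^-1].
  have /cvgrPdist_lt h : (fun P : tau => lawr S P F) @ nbhs (Q : tau) --> lawr S Q F.
    exact: lawr_atoms_continuous.
  exact: h.
have [P0 [AP0 P0Q]] := QA _ nearQ.
have [P1 [BP1 P1Q]] := QB _ nearQ.
have h0 := EA _ AP0; have h1 := EB _ BP1.
have := close P0 (or_introl (subset_closure AP0)).
have := close P1 (or_intror (subset_closure BP1)).
move: P0Q P1Q; rewrite /= !ler_norml !ltr_norml.
by move=> /andP[? ?] /andP[? ?] /andP[? ?] /andP[? ?]; lra.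
Qed.

End tests_to_closures.

Theorem theorem5p8 (R : realType) (Omega : ptopologicalType)
    (S : forall (P : fmeas R Omega) (n : nat), poisson_sample P n)
    (Theta0 Theta1 : set (fmeas R Omega)) :
  (forall Psi : set (borel Omega -> R),
     [set @bounded_continuous R Omega; @borel_indicators R Omega;
          @bounded_measurable R Omega] Psi ->
     precompact (Theta0 : set (tau_space Psi)) ->
     [disjoint closure (Theta0 : set (tau_space Psi)) &
               closure (Theta1 : set (tau_space Psi))]%classic ->
     distinguishable S Theta0 Theta1)
  /\
  (precompact (Theta0 : set (tau_space (@borel_indicators R Omega))) ->
   precompact (Theta1 : set (tau_space (@borel_indicators R Omega))) ->
   distinguishable S Theta0 Theta1 ->
   [disjoint closure (Theta0 : set (tau_space (@borel_indicators R Omega))) &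
             closure (Theta1 : set (tau_space (@borel_indicators R Omega)))]%classic).
Proof.
split=> [Psi /tau_choice_bmeas[P1 bPsi] cT0 /disj_setPS dis|cT0 cT1 dist].
  apply/separated_distinguishable.
  by apply: (disjoint_closures_separated _ P1 bPsi cT0); rewrite -subset0.
apply/eqP; apply: (@separated_disjoint_closures _ _ S _ _ cT0 cT1).
exact/separated_distinguishable.
Qed.
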